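(* Let $f\in C(\mathbb{R};\mathbb{R})$ satisfy $xf(x)>0$ for all $x\neq 0$ and $f(0)=0$, and let $\sigma\in C([0,\infty);\mathbb{R})$. For each $\xi\in\mathbb{R}$ let $X(\cdot,\xi)$ be any solution of $$dX(t)=-f(X(t))\,dt+\sigma(t)\,dB(t),\quad t\ge 0;\qquad X(0)=\xi .$$ Let $\theta(n)\ge 0$ be defined by $\theta^2(n)=\int_n^{n+1}\sigma^2(s)\,ds$. Then the following are equivalent: (A) $\displaystyle\sum_{n=1}^\infty \theta(n)\exp\left(-\frac12\frac{\epsilon^2}{\theta^2(n)}\right)<+\infty$ for every $\epsilon>0$; (B) $\lim_{t\to\infty}X(t,\xi)=0$ with positive probability for some $\xi\in\mathbb{R}$; (C) $\lim_{t\to\infty}X(t,\xi)=0$ almost surely for each $\xi\in\mathbb{R}$.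
   Context: $(\Omega,\mathcal{F},(\mathcal{F}(t))_{t\ge0},\mathbb{P})$ is a complete filtered probability space and $B$ is a standard one-dimensional Brownian motion adapted to $(\mathcal{F}(t))_{t\ge0}$. A solution of the stochastic differential equation is any continuous adapted process $X$ on $[0,\infty)$ such that, almost surely, $X(t)=\xi-\int_0^t f(X(s))\,ds+\int_0^t\sigma(s)\,dB(s)$ for all $t\ge0$; the initial value $\xi$ is deterministic and uniqueness of solutions is not assumed. The summand in (A) is interpreted as $0$ when $\theta(n)=0$. *)

(* Defs.v *)
From HB Require Import structures.
From mathcomp Require Import all_boot all_order all_algebra.
From mathcomp Require Import all_classical all_reals all_analysis.

Set Implicit Arguments.
Unset Strict Implicit.
Unset Printing Implicit Defensive.

Import Order.TTheory GRing.Theory Num.Theory.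
Import numFieldNormedType.Exports.

Local Open Scope classical_set_scope.
Local Open Scope ring_scope.

(* A process is a function [X : R -> T -> R] of time and scenario; only its
   values at times [t >= 0] are meaningful. *)

Definition measurable_wrt (d : measure_display) (T : measurableType d)
    (R : realType) (G : set (set T)) (Y : T -> R) : Prop :=
  preimage_set_system setT Y measurable `<=` G.

(* The last clause puts every subset of a null event in F(0). *)
Definition complete_filtration (d : measure_display) (T : measurableType d)
    (R : realType) (P : probability T R) (F : R -> set (set T)) : Prop :=
  [/\ measure_is_complete P,
      forall t : R, 0 <= t -> sigma_algebra setT (F t) /\ F t `<=` measurable,
      forall s t : R, 0 <= s -> s <= t -> F s `<=` F t &
      P.-negligible `<=` F 0].

Definition adapted (d : measure_display) (T : measurableType d)
    (R : realType) (F : R -> set (set T)) (X : R -> T -> R) : Prop :=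
  forall t : R, 0 <= t -> measurable_wrt (F t) (X t).

(* Continuity of paths is only required almost surely. *)
Definition continuous_process (d : measure_display) (T : measurableType d)
    (R : realType) (P : probability T R) (X : R -> T -> R) : Prop :=
  {ae P, forall w, {within `[0, +oo[, continuous (fun t => X t w)}}.

Definition increment (T : Type) (R : realType) (B : R -> T -> R) (s t : R)
    (w : T) : R := B t w - B s w.

(* Brownian motion relative to F: increments after time s are independent of
   F(s).  [normal_prob m s] is parametrized by the standard deviation. *)
Record brownian_motion (d : measure_display) (T : measurableType d)
    (R : realType) (P : probability T R) (F : R -> set (set T))
    (B : R -> T -> R) : Prop := BrownianMotion {
  bm_adapted : adapted F B ;
  bm_continuous : continuous_process P B ;
  bm_start : {ae P, forall w, B 0 w = 0} ;
  bm_indep : forall s t : R, 0 <= s -> s < t ->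
    forall (A : set T) (C : set R), F s A -> measurable C ->
      P (A `&` increment B s t @^-1` C) =
      (P A * P (increment B s t @^-1` C))%E ;
  bm_normal : forall s t : R, 0 <= s -> s < t ->
    forall C : set R, measurable C ->
      P (increment B s t @^-1` C) = normal_prob 0 (Num.sqrt (t - s)) C }.

(* The simple process \sum_(k < n) e_k 1_(t_k, t_(k+1)], with each e_k bounded
   and F(t_k)-measurable.  The times t_k and coefficients e_k are total
   sequences, of which only t_0, ..., t_n and e_0, ..., e_(n-1) are used. *)
Record simple_process (d : measure_display) (T : measurableType d)
    (R : realType) (F : R -> set (set T)) : Type := SimpleProcess {
  sp_size : nat ;
  sp_time : nat -> R ;
  sp_coef : nat -> T -> R ;
  sp_time_ge0 : 0 <= sp_time 0%N ;
  sp_time_homo : {homo sp_time : i j / (i <= j)%N >-> i <= j} ;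
  sp_coef_measurable : forall k, measurable_wrt (F (sp_time k)) (sp_coef k) ;
  sp_coef_bounded : forall k, exists M : R, forall w, `|sp_coef k w| <= M }.

Definition sp_value (d : measure_display) (T : measurableType d)
    (R : realType) (F : R -> set (set T)) (phi : simple_process F)
    (s : R) (w : T) : R :=
  \sum_(k < sp_size phi)
    sp_coef phi k w * \1_(`]sp_time phi k, sp_time phi k.+1]) s.

(* The integral of phi against B over [0, t]. *)
Definition sp_integral (d : measure_display) (T : measurableType d)
    (R : realType) (F : R -> set (set T)) (B : R -> T -> R)
    (phi : simple_process F) (t : R) (w : T) : R :=
  \sum_(k < sp_size phi)
    sp_coef phi k w *
    increment B (Num.min t (sp_time phi k)) (Num.min t (sp_time phi k.+1)) w.

(* J is (a version of) the Ito integral over [0, t] of the deterministic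
   integrand sigma: simple processes phi_n approximate sigma in L^2(P x ds),
   and their integrals converge to J in L^2(P). *)
Definition is_ito_integral (d : measure_display) (T : measurableType d)
    (R : realType) (P : probability T R) (F : R -> set (set T))
    (B : R -> T -> R) (sigma : R -> R) (t : R) (J : T -> R) : Prop :=
  exists phi : nat -> simple_process F,
    ((\int[P]_w \int[lebesgue_measure]_(s in `[0%R, t])
        ((sp_value (phi n) s w - sigma s) ^+ 2)%R%:E)%E @[n --> \oo] --> 0%E) /\
    ((\int[P]_w ((sp_integral B (phi n) t w - J w) ^+ 2)%R%:E)%E
        @[n --> \oo] --> 0%E).

Definition ito_integral_process (d : measure_display) (T : measurableType d)
    (R : realType) (P : probability T R) (F : R -> set (set T))
    (B : R -> T -> R) (sigma : R -> R) (I : R -> T -> R) : Prop :=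
  [/\ continuous_process P I, adapted F I &
      forall t : R, 0 <= t -> is_ito_integral P F B sigma t (I t)].

(* Solution of dX = - f(X) dt + sigma dB, X(0) = xi.  The exceptional null
   event does not depend on t, hence the continuous version I. *)
Definition is_solution (d : measure_display) (T : measurableType d)
    (R : realType) (P : probability T R) (F : R -> set (set T))
    (B : R -> T -> R) (f sigma : R -> R) (xi : R) (X : R -> T -> R) : Prop :=
  [/\ continuous_process P X, adapted F X &
      exists I : R -> T -> R, ito_integral_process P F B sigma I /\
        {ae P, forall w, forall t : R, 0 <= t ->
          X t w = xi - (\int[lebesgue_measure]_(s in `[0, t]) f (X s w))%R
                     + I t w}].

(* Main.v *)
Require Import Defs.
From HB Require Import structures.
From mathcomp Require Import all_boot all_order all_algebra.
From mathcomp Require Import all_classical all_reals all_analysis.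
From mathcomp Require Import measurable_realfun ring lra.

(* Write I for the Ito integral of sigma. Approximating I by integrals of
   deterministic step functions gives exponential moments of I(t) - I(s)
   conditionally on F(s), hence Gaussian upper tails (Chernoff) and lower tails
   (Paley-Zygmund); the exact law of I is never needed.

   (A) => (C). By a maximal inequality and Borel-Cantelli, (A) makes the
   oscillation of I over [n, n+1] tend to 0 almost surely. Moreover, almost
   surely, either the I(n) are bounded (when the theta(n)^2 are summable) or
   they are unbounded both above and below. The rest is pathwise. X cannot stay
   above some eta > 0: either I drags it below 0, or I is bounded, X remains in
   a compact subset of ]0, +oo[ on which f is bounded away from 0, and the drift
   diverges. And X, once below eps/2, cannot climb to eps, because on that band
   the drift beats the small oscillations of I. Then argue symmetrically for -X.

   (B) => (A). If X tends to 0 then so does I(n+1) - I(n). If (A) fails, the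
   converse Borel-Cantelli argument shows that this event is negligible. The
   event in (B) is not known to be measurable a priori, but a negligible event
   has measure 0 because P is complete. *)

Set Implicit Arguments.
Unset Strict Implicit.
Unset Printing Implicit Defensive.

Import Order.TTheory GRing.Theory Num.Theory.
Import numFieldNormedType.Exports.

Local Open Scope classical_set_scope.
Local Open Scope ring_scope.

(** * Moments of the normal law *)

Section normal_integrals.
Context {R : realType}.
Local Notation mu := (@lebesgue_measure R).
Implicit Types (s l x : R).

(** The integral is known only through random simple processes that may change with the time [t], so
    even its Gaussian law would have to be proved. Comparing increments in probability with step
    integrals costs constants: the tail bounds carry [8] in place of the Gaussian [2] from above,
    and [256] from below. The theorem tolerates this because (A) is quantified over every [epsilon]:
    a constant in the exponent is absorbed by rescaling [epsilon]. The prefactor [theta n] is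
    handled by giving up half of an exponent in one direction, and by showing [theta n <= 1]
    eventually in the other.

    Conditioning on the past is expressed throughout by intersecting with events [A] of [F s]. This
    is all that the three recursive arguments use: the first-exit decomposition of the maximal
    inequality, the geometric decay that yields unboundedness, and the converse Borel-Cantelli
    estimate.

    Randomness enters only through the path of [I]; every statement about [X] is deterministic and
    so holds for whichever solution is given. *)

Lemma ge0_integral_normal_prob s (g : R -> \bar R) :
  measurable_fun setT g -> (forall x, 0 <= g x)%E ->
  (\int[normal_prob 0%R s]_x g x = \int[mu]_x (g x * (normal_pdf 0%R s x)%:E))%E.
Proof.
move=> mg g0.
rewrite -(Radon_Nikodym_SigmaFinite.change_of_variables
  (normal_prob_dominates 0 s))//.
apply: ae_eq_integral => //.
- apply: emeasurable_funM => //; apply: (measurable_int mu).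
  apply: Radon_Nikodym_SigmaFinite.f_integrable.
  exact: normal_prob_dominates.
- apply: emeasurable_funM => //; apply/measurable_EFinP.
  exact: measurable_normal_pdf.
- apply: ae_eqe_mul2l => /=.
  apply: integral_ae_eq => //=.
  + apply: Radon_Nikodym_SigmaFinite.f_integrable.
    exact: normal_prob_dominates.
  + by apply/measurable_EFinP; exact: measurable_normal_pdf.
  + move=> E _ mE; rewrite -Radon_Nikodym_SigmaFinite.f_integral//.
    exact: normal_prob_dominates.
Qed.

(** Completing the square: [expR (l * x)] times the centred density is a constant multiple of the
    density with mean [l * s ^+ 2]. *)
Lemma mgf_normal_prob s l : 0 < s ->
  (\int[normal_prob 0%R s]_x (expR (l * x))%:E = (expR (l ^+ 2 * s ^+ 2 / 2))%:E)%E.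
Proof.
move=> s0; have sn0 : s != 0 by rewrite gt_eqF.
rewrite ge0_integral_normal_prob//; last first.
  by apply/measurable_EFinP; apply: measurableT_comp.
transitivity (\int[mu]_x ((expR (l ^+ 2 * s ^+ 2 / 2))%:E *
    (normal_pdf (l * s ^+ 2) s x)%:E))%E.
  apply: eq_integral => x _; rewrite -!EFinM; congr EFin.
  rewrite !normal_pdfE// mulrCA [RHS]mulrCA; congr *%R.
  rewrite /normal_fun -!expRD; congr expR.
  by field.
rewrite ge0_integralZl//.
- by rewrite integral_normal_pdf mule1.
- by apply/measurable_EFinP; exact: measurable_normal_pdf.
- by move=> x _; rewrite lee_fin normal_pdf_ge0.
Qed.

(** The substitution by [s * x] reduces every deviation to the standard law, so that a single
    constant remains. *)
Lemma second_moment_normal_prob s : 0 < s ->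
  (\int[normal_prob 0%R s]_x (x ^+ 2)%:E =
   (s ^+ 2)%:E * \int[normal_prob 0%R 1%R]_x (x ^+ 2)%:E)%E.
Proof.
move=> s0; have sn0 : s != 0 by rewrite gt_eqF.
have msq : measurable_fun setT (fun x : R => (x ^+ 2)%:E).
  by apply/measurable_EFinP; exact: exprn_measurable.
rewrite !ge0_integral_normal_prob//; try by move=> x; rewrite lee_fin sqr_ge0.
rewrite -ge0_integralZl//; last 3 first.
- apply: emeasurable_funM => //; apply/measurable_EFinP.
  exact: measurable_normal_pdf.
- by move=> x _; rewrite -EFinM lee_fin mulr_ge0// ?sqr_ge0// normal_pdf_ge0.
- by rewrite lee_fin sqr_ge0.
have dF x : derivable (fun x : R^o => s * x) x 1 by apply: derivableM.
have dFE : ((fun x : R^o => s * x)^`())%classic = cst s.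
  apply/funext => x; rewrite derive1E deriveM// derive_cst scaler0 addr0.
  by rewrite derive_id scaler1.
under eq_integral do rewrite -EFinM.
rewrite (@increasing_ge0_integration_by_substitutionT _ (fun x => s * x)
  (fun x => x ^+ 2 * normal_pdf 0 s x)); last 9 first.
- by move=> x y xy; rewrite ltr_pM2l.
- by rewrite dFE => x; exact: cvg_cst.
- by rewrite dFE; exact: is_cvg_cst.
- by rewrite dFE; exact: is_cvg_cst.
- exact: dF.
- by apply/gt0_cvgMrNy => //; exact: cvg_id.
- by apply/gt0_cvgMry => //; exact: cvg_id.
- move=> x; apply: cvgM; first exact: sqr_continuous.
  exact: continuous_normal_pdf.
- by move=> x; rewrite mulr_ge0// ?sqr_ge0// normal_pdf_ge0.
apply: eq_integral => x _; congr EFin.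
rewrite dFE !fctE /cst !normal_pdfE// /normal_fun /normal_peak.
have -> : Num.sqrt (s ^+ 2 * pi *+ 2) = s * Num.sqrt (1 ^+ 2 * pi *+ 2).
  by rewrite -!mulrnAr sqrtrM ?sqr_ge0// sqrtr_sqr gtr0_norm// expr1n mul1r.
have -> : - (s * x - 0) ^+ 2 / (s ^+ 2 *+ 2) = - (x - 0) ^+ 2 / (1 ^+ 2 *+ 2) :> R.
  by field.
have p0 : Num.sqrt (1 ^+ 2 * pi *+ 2) != 0 :> R.
  by rewrite gt_eqF// sqrtr_gt0 expr1n mul1r mulrn_wgt0// pi_gt0.
set p := Num.sqrt _ in p0 *; set e := expR _.
by field; rewrite p0.
Qed.

(** Equal to 1, but kept symbolic: the isometry serves only as an upper bound, for which a finite
    nonnegative constant is enough. *)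
Definition normal_m2 : R := fine (\int[normal_prob 0%R (1:R)]_x (x ^+ 2)%:E)%E.

Lemma sqr_le_expR x : x ^+ 2 <= 2 * (expR x + expR (- x)).
Proof.
have key (y : R) : 0 <= y -> y ^+ 2 <= 2 * expR y.
  move=> y0; have := expR_ge1Dxn 1 y0; rewrite (_ : 2`! = 2)%N// => h.
  by have : y ^+ 2 / 2 <= expR y; lra.
have [x0|x0] := leP 0 x.
  by have := key _ x0; have := expR_ge0 (- x); lra.
have := key (- x); rewrite oppr_ge0 sqrrN => /(_ (ltW x0)).
by have := expR_ge0 x; lra.
Qed.

Lemma measurable_sqr : measurable_fun [set: R] (fun x : R => (x ^+ 2)%:E).
Proof. by apply/measurable_EFinP; exact: exprn_measurable. Qed.

Lemma second_moment_normal_prob_lty s : 0 < s ->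
  (\int[normal_prob 0%R s]_x (x ^+ 2)%:E < +oo)%E.
Proof.
move=> s0.
have mE l : measurable_fun setT (fun x : R => (expR (l * x))%:E).
  by apply/measurable_EFinP; apply: measurableT_comp.
apply: (@le_lt_trans _ _ (\int[normal_prob 0%R s]_x
   (2%:E * ((expR (1 * x))%:E + (expR (-1 * x))%:E)))%E).
  apply: ge0_le_integral => //.
  - by move=> x _; rewrite lee_fin sqr_ge0.
  - exact: measurable_sqr.
  - by apply: emeasurable_funM => //; apply: emeasurable_funD; exact: mE.
  - by move=> x _; rewrite -EFinD -EFinM lee_fin mulN1r mul1r sqr_le_expR.
rewrite ge0_integralZl//; last 2 first.
- by apply: emeasurable_funD; exact: mE.
- by move=> x _; rewrite -EFinD lee_fin addr_ge0// expR_ge0.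
rewrite ge0_integralD//; try exact: mE.
rewrite !mgf_normal_prob//.
by rewrite -EFinD -EFinM ltry.
Qed.

Lemma normal_m2E s : 0 < s ->
  (\int[normal_prob 0%R s]_x (x ^+ 2)%:E = (s ^+ 2 * normal_m2)%:E)%E.
Proof.
move=> s0; rewrite second_moment_normal_prob// [RHS]EFinM /normal_m2 fineK//.
rewrite ge0_fin_numE; first exact: second_moment_normal_prob_lty.
by apply: integral_ge0 => x _; rewrite lee_fin sqr_ge0.
Qed.

Lemma normal_m2_ge0 : 0 <= normal_m2.
Proof.
by apply: fine_ge0; apply: integral_ge0 => x _; rewrite lee_fin sqr_ge0.
Qed.

Lemma integrable_sqr_normal_prob s : 0 < s ->
  (normal_prob 0 s).-integrable [set: R] (fun x : R => (x ^+ 2)%:E).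
Proof.
move=> s0; apply/integrableP; split; first exact: measurable_sqr.
under eq_integral do rewrite gee0_abs ?lee_fin ?sqr_ge0//.
exact: second_moment_normal_prob_lty.
Qed.

Lemma integrable_id_normal_prob s : 0 < s ->
  (normal_prob 0 s).-integrable [set: R] (fun x : R => x%:E).
Proof.
move=> s0; apply: (@le_integrable _ _ _ (normal_prob 0 s) _ _ _
   (fun x : R => (1 + x ^+ 2)%:E)) => //.
- exact/measurable_EFinP.
- move=> x _; rewrite /= lee_fin [leRHS]ger0_norm ?addr_ge0 ?sqr_ge0//.
  by rewrite ler_norml; apply/andP; split; nra.
- under eq_fun do rewrite EFinD.
  apply: integrableD => //; last exact: integrable_sqr_normal_prob.
  exact: finite_measure_integrable_cst.
Qed.

(** Integrating [1 + l * x <= expR (l * x)] bounds [l * m] by a quantity of order [l ^+ 2] for every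
    [l] of either sign; small [l] then rules out [m != 0]. *)
Lemma mean_normal_prob s : 0 < s -> (\int[normal_prob 0%R s]_x x%:E = 0)%E.
Proof.
move=> s0.
have mE l : measurable_fun setT (fun x : R => (expR (l * x))%:E).
  by apply/measurable_EFinP; apply: measurableT_comp.
have iE l : (normal_prob 0 s).-integrable [set: R] (fun x : R => (expR (l * x))%:E).
  apply/integrableP; split; first exact: mE.
  under eq_integral do rewrite gee0_abs ?lee_fin ?expR_ge0//.
  by rewrite mgf_normal_prob// ltry.
have iid := integrable_id_normal_prob s0.
set m := (\int[normal_prob 0%R s]_x x%:E)%E.
have mfin : m \is a fin_num by exact: integrable_fin_num.
have key l : (l%:E * m <= (expR (l ^+ 2 * s ^+ 2 / 2) - 1)%:E)%E.
  have i1 : (normal_prob 0 s).-integrable [set: R] (fun=> 1%:E).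
    exact: finite_measure_integrable_cst.
  have -> : ((expR (l ^+ 2 * s ^+ 2 / 2) - 1)%:E =
      \int[normal_prob 0%R s]_x ((expR (l * x))%:E - 1%:E))%E.
    rewrite integralB// mgf_normal_prob// integral_cst//= mul1e.
    by rewrite probability_setT.
  rewrite /m -integralZl//; apply: le_integral => //.
  - exact: integrableZl.
  - exact: integrableB.
  - move=> x _; rewrite -EFinM -EFinD lee_fin.
    by have := expR_ge1Dx (l * x); lra.
have exp_le (y : R) : 0 <= y -> y <= 2^-1 -> expR y - 1 <= 2 * y.
  move=> y0 y2; have := expR_ge1Dx (- y); rewrite expRN => h.
  have e0 := expR_gt0 y.
  have : (1 - y) * expR y <= 1.
    by rewrite -ler_pdivlMr// div1r.
  by nra.
move: mfin key; case: m => // m _ key; congr EFin.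
apply/eqP/negPn/negP => m0.
have m2 : 0 < m ^+ 2 by rewrite exprn_even_gt0.
(* The trial point is [l = m / K]. The last summand of [K] gives [(m / K) ^+ 2 * s ^+ 2 <= 1], which
   puts the exponent in the range of [exp_le]; the first gives [s ^+ 2 / K < 1], which contradicts
   the resulting inequality. *)
pose K := 2 * s ^+ 2 + 1 + m ^+ 2 * s ^+ 2.
have K1 : 1 <= K by rewrite /K; nra.
have K0 : 0 < K by lra.
have s2 : 0 < s ^+ 2 by rewrite exprn_gt0.
have lsE : (m / K) ^+ 2 * s ^+ 2 = m ^+ 2 * s ^+ 2 / K ^+ 2.
  by field; rewrite gt_eqF.
have ls : (m / K) ^+ 2 * s ^+ 2 <= 1.
  rewrite lsE ler_pdivrMr ?exprn_gt0// mul1r.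
  apply: (@le_trans _ _ K); first by rewrite /K; nra.
  by rewrite expr2 ler_peMr// ltW.
have := key (m / K); rewrite -EFinM lee_fin => h.
have := exp_le ((m / K) ^+ 2 * s ^+ 2 / 2).
have ls0 : 0 <= (m / K) ^+ 2 * s ^+ 2 by rewrite mulr_ge0 ?sqr_ge0.
move=> /(_ ltac:(lra) ltac:(lra)) h2.
have : m ^+ 2 / K <= m ^+ 2 * s ^+ 2 / K ^+ 2.
  by rewrite -lsE; move: h h2; rewrite mulrAC -expr2; lra.
have -> : m ^+ 2 * s ^+ 2 / K ^+ 2 = (m ^+ 2 / K) * (s ^+ 2 / K).
  by field; rewrite gt_eqF.
apply/negP; rewrite -ltNge gtr_pMr ?divr_gt0// ltr_pdivrMr// mul1r /K.
by nra.
Qed.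

End normal_integrals.

Arguments normal_m2 : clear implicits.

(** * Independence of a sigma-algebra *)

Section measurable_wrt_theory.
Context d (T : measurableType d) (R : realType).
Implicit Types (G : set (set T)) (Y Z : T -> R).

(** Turns the set system [G] into a measurable type, so that the closure properties of measurable
    functions apply to [G]. *)
Lemma measurable_wrtP G Y : sigma_algebra setT G ->
  measurable_wrt G Y <-> measurable_fun [set: g_sigma_algebraType G] Y.
Proof.
move=> sG; split => [mY _ C mC|mY _ [C mC <-]].
  by rewrite -(sigma_algebra_id sG) in mY; apply: mY; exists C.
by rewrite -(sigma_algebra_id sG); exact: mY.
Qed.

Lemma measurable_wrt_sub G G' Y : G `<=` G' ->
  measurable_wrt G Y -> measurable_wrt G' Y.
Proof. by move=> GG' mY; apply: subset_trans GG'. Qed.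

Lemma measurable_wrt_measurable G Y : G `<=` measurable ->
  measurable_wrt G Y -> measurable_fun setT Y.
Proof. by move=> Gm mY _ C mC; apply/Gm/mY; exists C. Qed.

Lemma measurable_wrt_comp2 G Y Z (h : R -> R -> R) : sigma_algebra setT G ->
  (forall d' (U : measurableType d') (y z : U -> R), measurable_fun setT y ->
     measurable_fun setT z -> measurable_fun setT (fun w => h (y w) (z w))) ->
  measurable_wrt G Y -> measurable_wrt G Z ->
  measurable_wrt G (fun w => h (Y w) (Z w)).
Proof.
move=> sG mh /(measurable_wrtP _ sG) mY /(measurable_wrtP _ sG) mZ.
exact/(measurable_wrtP _ sG)/mh.
Qed.

Lemma measurable_wrtM G Y Z : sigma_algebra setT G ->
  measurable_wrt G Y -> measurable_wrt G Z ->
  measurable_wrt G (fun w => Y w * Z w).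
Proof.
move=> sG; apply: (@measurable_wrt_comp2 _ _ _ *%R sG) => *.
exact: measurable_funM.
Qed.

Lemma measurable_wrtB G Y Z : sigma_algebra setT G ->
  measurable_wrt G Y -> measurable_wrt G Z ->
  measurable_wrt G (fun w => Y w - Z w).
Proof.
move=> sG; apply: (@measurable_wrt_comp2 _ _ _ (fun y z => y - z) sG) => *.
exact: measurable_funB.
Qed.

Lemma measurable_wrt_indic G A : sigma_algebra setT G -> G A ->
  measurable_wrt G (\1_A : T -> R).
Proof.
move=> sG GA; apply/(measurable_wrtP _ sG).
by apply: measurable_indic; rewrite /measurable/= sigma_algebra_id.
Qed.

Lemma measurable_wrt_cst G (c : R) : sigma_algebra setT G ->
  measurable_wrt G (fun=> c).
Proof. by move=> sG; apply/(measurable_wrtP _ sG); exact: measurable_cst. Qed.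

Lemma measurable_wrt_preimage G Y (C : set R) : measurable C ->
  measurable_wrt G Y -> G (Y @^-1` C).
Proof. by move=> mC mY; apply: mY; exists C => //; rewrite setTI. Qed.

End measurable_wrt_theory.

Section independent_product.
Context d (T : measurableType d) (R : realType) (P : probability T R).
Variables (G : set (set T)) (D : T -> R).
Variable nu : probability (measurableTypeR R) R.
Hypothesis Gm : G `<=` measurable.
Hypothesis mD : measurable_fun setT D.
Hypothesis indD : forall A (C : set R), G A -> measurable C ->
  P (A `&` D @^-1` C) = (P A * nu C)%E.
Variable Z : T -> R.
Hypothesis mZ : measurable_wrt G Z.

Let mZ' : measurable_fun setT (Z : T -> measurableTypeR R).
Proof. exact: measurable_wrt_measurable mZ. Qed.
Let Zm : {mfun T >-> measurableTypeR R} :=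
  HB.pack Z (isMeasurableFun.Build _ _ _ _ _ mZ').
Let mZD : measurable_fun setT
  (fun w => (Z w, D w) : (measurableTypeR R * measurableTypeR R)%type).
Proof. exact: measurable_fun_pair. Qed.
Let ZDm : {mfun T >-> (measurableTypeR R * measurableTypeR R)%type} :=
  HB.pack (fun w => (Z w, D w) : (measurableTypeR R * measurableTypeR R)%type)
   (isMeasurableFun.Build _ _ _ _ _ mZD).

(** Independence makes the law of [(Z, D)] agree with the product law on rectangles, and a measure
    with this property is unique. *)
Let joint (C : set (measurableTypeR R * measurableTypeR R)) : measurable C ->
  (distribution P Zm \x nu)%E C = distribution P ZDm C.
Proof.
apply: product_measure_unique => A B mA mB.
rewrite /distribution /pushforward/= -indD//; last first.
  exact: measurable_wrt_preimage.
Qed.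

Lemma ge0_integral_indepM (g : measurableTypeR R -> R) : measurable_fun setT g ->
  (forall w, 0 <= Z w) -> (forall x, 0 <= g x) ->
  (\int[P]_w (Z w * g (D w))%:E =
   \int[P]_w (Z w)%:E * \int[nu]_x (g x)%:E)%E.
Proof.
move=> mg Z0 g0.
have mgE : measurable_fun setT (EFin \o g) by exact/measurable_EFinP.
(* The absolute value makes [h] nonnegative on the whole plane, as Tonelli requires, and changes
   nothing along [Z]. *)
pose h (z : measurableTypeR R * measurableTypeR R) : \bar R :=
  (`|z.1| * g z.2)%:E.
have mh : measurable_fun setT h.
  apply/measurable_EFinP; apply: measurable_funM.
    by apply: measurableT_comp => //; exact: measurable_fst.
  by apply: measurableT_comp => //; exact: measurable_snd.
have h0 z : (0 <= h z)%E by rewrite lee_fin mulr_ge0.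
transitivity (\int[distribution P ZDm]_z h z)%E.
  rewrite ge0_integral_distribution//; apply: eq_integral => w _.
  by rewrite /h/= ger0_norm.
rewrite (@eq_measure_integral _ _ _ _ (distribution P Zm \x nu)%E); last first.
  by move=> A mA _; exact/esym/joint.
rewrite fubini_tonelli1// /fubini_F/=.
transitivity (\int[distribution P Zm]_z
    ((`|z : R|)%:E * \int[nu]_x (g x)%:E))%E.
  apply: eq_integral => z _; rewrite /h/=; under eq_integral do rewrite EFinM.
  by rewrite ge0_integralZl// => x _; rewrite lee_fin.
rewrite ge0_integralZr//; last 2 first.
- by apply/measurable_EFinP; exact: normr_measurable.
- by apply: integral_ge0 => x _; rewrite lee_fin.
rewrite ge0_integral_distribution//; last first.
  by apply/measurable_EFinP; exact: normr_measurable.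
by congr *%E; apply: eq_integral => w _; rewrite /= ger0_norm.
Qed.

Lemma integral_indepM (g : measurableTypeR R -> R) :
  P.-integrable setT (EFin \o Z) -> nu.-integrable setT (EFin \o g) ->
  P.-integrable setT (fun w => (Z w * g (D w))%:E) /\
  (\int[P]_w (Z w * g (D w))%:E =
   \int[P]_w (Z w)%:E * \int[nu]_x (g x)%:E)%E.
Proof.
move=> iZ ig.
have mg : measurable_fun setT g.
  by apply/measurable_EFinP; case/integrableP : ig.
pose h (z : measurableTypeR R * measurableTypeR R) : \bar R :=
  (z.1 * g z.2)%:E.
have mh : measurable_fun setT h.
  apply/measurable_EFinP; apply: measurable_funM; first exact: measurable_fst.
  by apply: measurableT_comp => //; exact: measurable_snd.
have eqm A : measurable A -> A `<=` setT ->
    distribution P ZDm A = (distribution P Zm \x nu)%E A.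
  by move=> mA _; exact/esym/joint.
have ig' : (\int[nu]_x `|(g x)%:E| < +oo)%E by case/integrableP : ig.
have iZ' : (\int[P]_w `|(Z w)%:E| < +oo)%E by case/integrableP : iZ.
have mag : measurable_fun setT (fun x : measurableTypeR R => `|g x|%:E).
  by apply/measurable_EFinP; exact: measurableT_comp.
have maz : measurable_fun setT (fun z : measurableTypeR R => (`|z : R|)%:E).
  by apply/measurable_EFinP; exact: normr_measurable.
have FE : (\int[distribution P Zm]_z \int[nu]_x `|h (z, x)| =
    \int[P]_w `|(Z w)%:E| * \int[nu]_x `|(g x)%:E|)%E.
  transitivity (\int[distribution P Zm]_z
      (`|(z : R)%:E| * \int[nu]_x `|(g x)%:E|))%E.
    apply: eq_integral => z _; rewrite /h/= -ge0_integralZl//.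
    by apply: eq_integral => x _; rewrite -EFinM normrM.
  rewrite ge0_integralZr//; last exact: integral_ge0.
  by rewrite ge0_integral_distribution.
have ih : (distribution P Zm \x nu)%E.-integrable setT h.
  apply/integrable12ltyP => //.
  by rewrite FE lte_mul_pinfty// ?ge0_fin_numE//; exact: integral_ge0.
have ih' : P.-integrable setT (h \o ZDm).
  apply/integrableP; split; first exact: measurableT_comp.
  have mah : measurable_fun setT (abse \o h) by exact: measurableT_comp.
  rewrite -(ge0_integral_distribution ZDm mah); last by move=> y; exact: abse_ge0.
  rewrite (@eq_measure_integral _ _ _ _ (distribution P Zm \x nu)%E)//.
  by case/integrableP : ih.
split => //.
transitivity (\int[distribution P ZDm]_z h z)%E.
  by rewrite integral_distribution.
rewrite (@eq_measure_integral _ _ _ _ (distribution P Zm \x nu)%E)//.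
rewrite -integral12_prod_meas1//= /fubini_F.
transitivity (\int[distribution P Zm]_z
    ((z : R)%:E * \int[nu]_x (g x)%:E))%E.
  by apply: eq_integral => z _; rewrite /h/= -integralZl.
have gfin : (\int[nu]_x (g x)%:E)%E \is a fin_num by exact: integrable_fin_num.
rewrite -(fineK gfin) integralZr//; last first.
  apply/integrableP; split; first exact/measurable_EFinP.
  by rewrite ge0_integral_distribution.
by rewrite integral_distribution//; exact/measurable_EFinP.
Qed.

End independent_product.

(** * The Ito isometry for simple integrands *)

Section has_mean.
Context d (T : measurableType d) (R : realType).
Variable P : {measure set T -> \bar R}.
Implicit Types (X Y : T -> R).

(** Integrability travels with the value, so expanding a squared sum is plain linearity. The measure
    is arbitrary because the isometry also integrates in time. *)
Definition has_mean X (m : R) := P.-integrable setT (EFin \o X) /\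
  (\int[P]_w (X w)%:E)%E = m%:E.

Lemma eq_has_mean X Y m n : X =1 Y -> m = n -> has_mean X m -> has_mean Y n.
Proof. by move=> /funext -> ->. Qed.

Lemma has_meanD X Y m n : has_mean X m -> has_mean Y n ->
  has_mean (fun w => X w + Y w) (m + n).
Proof.
move=> [iX mX] [iY mY]; split.
  by under [EFin \o _]eq_fun do rewrite EFinD; exact: integrableD.
by under eq_integral do rewrite EFinD; rewrite integralD// mX mY.
Qed.

Lemma has_meanZ X m c : has_mean X m -> has_mean (fun w => c * X w) (c * m).
Proof.
move=> [iX mX]; split.
  by under [EFin \o _]eq_fun do rewrite EFinM; exact: integrableZl.
by under eq_integral do rewrite EFinM; rewrite integralZl// mX.
Qed.

Lemma has_mean0 : has_mean (fun=> 0) 0.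
Proof. by split; [exact: integrable0|rewrite integral0]. Qed.

Lemma has_mean_sum (I : Type) (r : seq I) (X : I -> T -> R) (m : I -> R) :
  (forall i, has_mean (X i) (m i)) ->
  has_mean (fun w => \sum_(i <- r) X i w) (\sum_(i <- r) m i).
Proof.
move=> h; elim: r => [|i r ih].
  by rewrite big_nil; under eq_fun do rewrite big_nil; exact: has_mean0.
by rewrite big_cons; under eq_fun do rewrite big_cons; exact: has_meanD.
Qed.

Lemma has_mean_sqr_sum (I : finType) (X : I -> T -> R) (m : I -> I -> R) :
  (forall i j, has_mean (fun w => X i w * X j w) (m i j)) ->
  has_mean (fun w => (\sum_i X i w) ^+ 2) (\sum_i \sum_j m i j).
Proof.
move=> h; have := has_mean_sum (index_enum I)
  (fun i => has_mean_sum (index_enum I) (h i)).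
by apply: eq_has_mean => // w; rewrite expr2 big_distrlr.
Qed.

End has_mean.

Section bounded_rv.
Context d (T : measurableType d) (R : realType) (P : probability T R).
Implicit Types (X Y : T -> R).

Definition bounded_rv X := exists M : R, forall w, `|X w| <= M.

Lemma bounded_rvM X Y : bounded_rv X -> bounded_rv Y ->
  bounded_rv (fun w => X w * Y w).
Proof.
move=> [M hM] [N hN]; exists (M * N) => w.
by rewrite normrM ler_pM.
Qed.

Lemma integrable_boundedM X Y : measurable_fun setT X -> bounded_rv X ->
  P.-integrable setT (EFin \o Y) -> P.-integrable setT (fun w => (X w * Y w)%:E).
Proof.
move=> mX [M hM] iY.
have mY : measurable_fun setT Y by apply/measurable_EFinP; case/integrableP : iY.
apply: (le_integrable _ _ _ (integrableZl _ M iY)) => //.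
  by apply/measurable_EFinP; exact: measurable_funM.
move=> w _; rewrite /= lee_fin !normrM ler_wpM2r//.
by rewrite (le_trans (hM w))// ler_norm.
Qed.

Lemma integrable_bounded X : measurable_fun setT X -> bounded_rv X ->
  P.-integrable setT (EFin \o X).
Proof.
move=> mX bX.
have i1 : P.-integrable setT (EFin \o (fun=> 1 : R)).
  exact: finite_measure_integrable_cst.
have := integrable_boundedM mX bX i1.
by under eq_fun do rewrite /= mulr1.
Qed.

End bounded_rv.

Section brownian.
Context (d : measure_display) (T : measurableType d)
    (R : realType) (P : probability T R) (F : R -> set (set T)) (B : R -> T -> R).
Hypotheses (hF : complete_filtration P F) (hB : brownian_motion P F B).
Implicit Types (u v s t : R) (Z : T -> R).

Lemma filtration_sigma t : 0 <= t -> sigma_algebra setT (F t).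
Proof. by case: hF => _ + _ _ t0 => /(_ _ t0)[]. Qed.

Lemma filtration_measurable t : 0 <= t -> F t `<=` measurable.
Proof. by case: hF => _ + _ _ t0 => /(_ _ t0)[]. Qed.

Lemma filtration_le s t : 0 <= s -> s <= t -> F s `<=` F t.
Proof. by case: hF => _ _ + _; exact. Qed.

Lemma increment_wrt s t u : 0 <= s -> s <= t -> t <= u ->
  measurable_wrt (F u) (increment B s t).
Proof.
move=> s0 st tu; apply: measurable_wrtB.
- by apply: filtration_sigma; lra.
- apply: (@measurable_wrt_sub _ _ _ (F t)); last by apply: bm_adapted hB _ _; lra.
  by apply: filtration_le => //; lra.
- apply: (@measurable_wrt_sub _ _ _ (F s)); last by apply: bm_adapted hB _ _; lra.
  by apply: filtration_le => //; lra.
Qed.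

Lemma increment_measurable s t : 0 <= s -> s <= t ->
  measurable_fun setT (increment B s t).
Proof.
move=> s0 st; apply: (@measurable_wrt_measurable _ _ _ (F t)).
  by apply: filtration_measurable; lra.
exact: increment_wrt.
Qed.

Lemma increment_indep s t (A : set T) (C : set R) : 0 <= s -> s < t ->
  F s A -> measurable C ->
  P (A `&` increment B s t @^-1` C) = (P A * normal_prob 0%R (Num.sqrt (t - s)) C)%E.
Proof.
by move=> s0 st FA mC; rewrite (bm_indep hB)// (bm_normal hB).
Qed.

Lemma has_mean_increment u v Z : 0 <= u -> u <= v -> measurable_wrt (F u) Z ->
  P.-integrable setT (EFin \o Z) -> has_mean P (fun w => Z w * increment B u v w) 0.
Proof.
move=> u0; rewrite le_eqVlt => /predU1P[<- _ _|uv mZ iZ].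
  apply: eq_has_mean (has_mean0 P) => // w.
  by rewrite /increment subrr mulr0.
have s0 : 0 < Num.sqrt (v - u) by rewrite sqrtr_gt0 subr_gt0.
have [h1 h2] := integral_indepM (filtration_measurable u0)
  (increment_measurable u0 (ltW uv))
  (fun A C FA mC => @increment_indep u v A C u0 uv FA mC) mZ iZ
  (integrable_id_normal_prob s0).
by split => //; rewrite h2 mean_normal_prob// mule0.
Qed.

Lemma has_mean_increment_sqr u v Z m : 0 <= u -> u <= v -> measurable_wrt (F u) Z ->
  has_mean P Z m ->
  has_mean P (fun w => Z w * increment B u v w ^+ 2) (normal_m2 R * (v - u) * m).
Proof.
move=> u0; rewrite le_eqVlt => /predU1P[<- _ _|uv mZ [iZ Zm]].
  apply: eq_has_mean (has_mean0 P) => [w|].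
    by rewrite /increment subrr expr0n mulr0.
  by rewrite subrr mulr0 mul0r.
have s0 : 0 < Num.sqrt (v - u) by rewrite sqrtr_gt0 subr_gt0.
have [h1 h2] := integral_indepM (filtration_measurable u0)
  (increment_measurable u0 (ltW uv))
  (fun A C FA mC => @increment_indep u v A C u0 uv FA mC) mZ iZ
  (integrable_sqr_normal_prob s0).
split => //; rewrite h2 normal_m2E// Zm sqr_sqrtr ?subr_ge0 1?ltW//.
by rewrite -EFinM; congr EFin; ring.
Qed.

(** The length of the intersection of []a, b]] and []a', b']], which is the covariance of the two
    Brownian increments up to [normal_m2]. *)
Definition overlap (a b a' b' : R) : R :=
  Num.max 0 (Num.min b b' - Num.max a a').

(** Both increments are cut at [a'] and at the smaller right end point [p]. In each cross product
    the last increment is independent of the other factors and has mean zero, or else a factor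
    vanishes because [p] is [b] or [b']; only the square over []a', p]] survives. *)
Let has_mean_pair_le (e e' : T -> R) (a b a' b' m : R) : 0 <= a -> a <= b ->
  a' <= b' -> a <= a' ->
  measurable_wrt (F a) e -> measurable_wrt (F a') e' -> bounded_rv e -> bounded_rv e' ->
  has_mean P (fun w => e w * e' w) m ->
  has_mean P (fun w => (e w * increment B a b w) * (e' w * increment B a' b' w))
    (normal_m2 R * overlap a b a' b' * m).
Proof.
move=> a0 ab ab' aa' me me' be be' hm.
have a'0 : 0 <= a' by lra.
have sub u v : 0 <= u -> u <= v -> F u `<=` F v by exact: filtration_le.
have Fe v : a <= v -> measurable_wrt (F v) e.
  by move=> av; apply: measurable_wrt_sub me; exact: sub.
have Fe' v : a' <= v -> measurable_wrt (F v) e'.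
  by move=> av; apply: measurable_wrt_sub me'; exact: sub.
have Fee' v : a' <= v -> measurable_wrt (F v) (fun w => e w * e' w).
  move=> av; apply: measurable_wrtM; [apply: filtration_sigma; lra|apply: Fe; lra|exact: Fe'].
have mee' : measurable_fun setT (fun w => e w * e' w).
  by apply: measurable_wrt_measurable (Fee' _ (lexx _)); exact: filtration_measurable.
have iI u v : 0 <= u -> u <= v -> P.-integrable setT (EFin \o (increment B u v)).
  move=> u0 uv.
  have h1 : has_mean P (fun w : T => 1) 1.
    split; first exact: finite_measure_integrable_cst.
    by rewrite integral_cst//= probability_setT mule1.
  have [+ _] := has_mean_increment u0 uv (@measurable_wrt_cst _ _ _ _ 1 (filtration_sigma u0)) h1.1.
  by under [EFin \o _]eq_fun do rewrite /= mul1r.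
have key u v q r : 0 <= u -> u <= v -> a' <= q -> v <= q -> q <= r ->
    has_mean P (fun w => (e w * e' w * increment B u v w) * increment B q r w) 0.
  move=> u0 uv aq vq qr; apply: has_mean_increment; [lra|exact: qr| |].
  - apply: measurable_wrtM; first by apply: filtration_sigma; lra.
    + by apply: Fee'; lra.
    + exact: increment_wrt.
  - apply: integrable_boundedM => //; first exact: bounded_rvM.
    exact: iI.
have [ba'|a'b] := leP b a'.
  apply: eq_has_mean (key a b a' b' a0 ab (lexx _) ba' ab') => [w|]; first ring.
  have -> : overlap a b a' b' = 0.
    rewrite /overlap; apply/max_idPl; rewrite subr_le0.
    by rewrite ge_min le_max ba' orbT.
  by rewrite mulr0 mul0r.
pose p := Num.min b b'.
have pb : p <= b by rewrite ge_min lexx.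
have pb' : p <= b' by rewrite ge_min lexx orbT.
have a'p : a' <= p by rewrite le_min (ltW a'b).
have ovE : overlap a b a' b' = p - a'.
  rewrite /overlap -/p (max_idPr aa'); apply/max_idPr; lra.
have h1 := key a a' a' p a0 aa' (lexx _) (lexx _) a'p.
have h2 := key a a' p b' a0 aa' a'p a'p pb'.
have h3 := has_mean_increment_sqr a'0 a'p (Fee' _ (lexx _)) hm.
have h4 := key a' p p b' a'0 a'p a'p (lexx _) pb'.
have h5 := key a' p p b a'0 a'p a'p (lexx _) pb.
have := has_meanD h1 (has_meanD h2 (has_meanD h3 (has_meanD h4 h5))).
apply: eq_has_mean => [w|]; last by rewrite ovE; ring.
have : (B b w - B p w) * (B b' w - B p w) = 0.
  rewrite /p; case: (leP b b') => _; rewrite subrr ?mul0r ?mulr0//.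
rewrite /increment => h0.
have -> : (e w * (B b w - B a w)) * (e' w * (B b' w - B a' w)) =
   e w * e' w * ((B b w - B a w) * (B b' w - B a' w)) by ring.
have -> : (B b w - B a w) * (B b' w - B a' w) =
   (B a' w - B a w) * (B p w - B a' w) + (B a' w - B a w) * (B b' w - B p w) +
   (B p w - B a' w) ^+ 2 + (B p w - B a' w) * (B b' w - B p w) +
   (B p w - B a' w) * (B b w - B p w) + (B b w - B p w) * (B b' w - B p w) by ring.
by rewrite h0; ring.
Qed.

Lemma overlapC (a b a' b' : R) : overlap a b a' b' = overlap a' b' a b.
Proof. by rewrite /overlap (minC b) (maxC a). Qed.

Lemma has_mean_pair (e e' : T -> R) (a b a' b' m : R) : 0 <= a -> a <= b ->
  0 <= a' -> a' <= b' ->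
  measurable_wrt (F a) e -> measurable_wrt (F a') e' -> bounded_rv e -> bounded_rv e' ->
  has_mean P (fun w => e w * e' w) m ->
  has_mean P (fun w => (e w * increment B a b w) * (e' w * increment B a' b' w))
    (normal_m2 R * overlap a b a' b' * m).
Proof.
move=> a0 ab a'0 ab' me me' be be' hm.
have [aa'|/ltW aa'] := leP a a'; first exact: has_mean_pair_le.
rewrite overlapC; apply: eq_has_mean (has_mean_pair_le a'0 ab' ab aa' me' me be' be _).
- by move=> w; rewrite mulrC.
- by [].
- by apply: eq_has_mean hm => // w; rewrite mulrC.
Qed.

Lemma lebesgue_measure_overlap (a b a' b' : R) :
  lebesgue_measure (`]a, b] `&` `]a', b']) = (overlap a b a' b')%:E.
Proof.
have -> : `]a, b] `&` `]a', b'] = `]Num.max a a', Num.min b b']%classic.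
  apply/seteqP; split => [x [/=]|x /=]; rewrite !in_itv/= gt_max le_min.
    by move=> /andP[-> ->] /andP[-> ->].
  by move=> /andP[/andP[-> ->] /andP[-> ->]].
rewrite lebesgue_measure_itv/= lte_fin /overlap.
by case: ltP => h; [rewrite -EFinD|]; congr EFin; apply/esym;
  [apply/max_idPr|apply/max_idPl]; lra.
Qed.

(** The intervals may overlap and the index type is any finite type, so integrals over different
    partitions can be subtracted without a common refinement. Both sides expand into the same double
    sum of overlaps. *)
Lemma ito_isometry (I : finType) (e : I -> T -> R) (a b : I -> R) :
  (forall i, 0 <= a i) -> (forall i, a i <= b i) ->
  (forall i, measurable_wrt (F (a i)) (e i)) -> (forall i, bounded_rv (e i)) ->
  exists m, has_mean P
    (fun w => (\sum_i e i w * increment B (a i) (b i) w) ^+ 2) (normal_m2 R * m) /\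
  (\int[P]_w \int[lebesgue_measure]_r
     ((\sum_i e i w * \1_`]a i, b i] r) ^+ 2)%:E = m%:E)%E.
Proof.
move=> a0 ab me be.
have me' i : measurable_fun setT (e i).
  by apply: measurable_wrt_measurable (me i); exact: filtration_measurable.
pose m i j := fine (\int[P]_w (e i w * e j w)%:E)%E.
have hm i j : has_mean P (fun w => e i w * e j w) (m i j).
  have ie : P.-integrable setT (EFin \o (fun w => e i w * e j w)).
    apply: integrable_bounded; last exact: bounded_rvM.
    exact: measurable_funM.
  by split => //; rewrite fineK//; exact: integrable_fin_num.
exists (\sum_i \sum_j overlap (a i) (b i) (a j) (b j) * m i j); split.
  have := has_mean_sqr_sum (fun i j => has_mean_pair (a0 i) (ab i) (a0 j) (ab j)
    (me i) (me j) (be i) (be j) (hm i j)).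
  apply: eq_has_mean => //.
  rewrite mulr_sumr; apply: eq_bigr => i _; rewrite mulr_sumr.
  by apply: eq_bigr => j _; rewrite mulrA.
have inner w : has_mean lebesgue_measure
   (fun r => (\sum_i e i w * \1_`]a i, b i] r) ^+ 2)
   (\sum_i \sum_j overlap (a i) (b i) (a j) (b j) * (e i w * e j w)).
  apply: has_mean_sqr_sum => i j.
  have : has_mean lebesgue_measure
     (fun r => \1_(`]a i, b i] `&` `]a j, b j]) r) (overlap (a i) (b i) (a j) (b j)).
    have mI : measurable ((`]a i, b i] `&` `]a j, b j])%classic : set R).
      exact: measurableI.
    split; last by rewrite integral_indic// setIT; exact: lebesgue_measure_overlap.
    apply/integrableP; split.
      by apply/measurable_EFinP; exact: measurable_indic.
    under eq_integral do rewrite /= ger0_norm//.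
    by rewrite integral_indic// setIT [ltLHS]lebesgue_measure_overlap ltry.
  move/(has_meanZ (e i w * e j w)); apply: eq_has_mean; last by rewrite mulrC.
  by move=> r; rewrite indicI/=; ring.
have := has_mean_sum (index_enum I) (fun i => has_mean_sum (index_enum I)
   (fun j => has_meanZ (overlap (a i) (b i) (a j) (b j)) (hm i j))).
move=> [_ <-]; apply: eq_integral => w _.
by have [_ ->] := inner w.
Qed.

End brownian.

Lemma chebyshev_sqr d (T : measurableType d) (R : realType) (P : probability T R)
    (W : T -> R) (delta : R) : measurable_fun setT W -> 0 < delta ->
  (P [set w | (delta < `|W w|)%R] <= (delta ^- 2)%:E * \int[P]_w (W w ^+ 2)%:E)%E.
Proof.
move=> mW delta0.
have mA : measurable [set w | delta < `|W w|].
  rewrite -[X in measurable X]setTI.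
  by apply: measurable_fun_ltr => //; exact: measurableT_comp.
have mW2 : measurable_fun setT (fun w => (W w ^+ 2)%:E).
  by apply/measurable_EFinP; exact: measurable_funX.
rewrite -[X in P X]setIT -integral_indic//= -ge0_integralZl//; last 2 first.
- by move=> w _; rewrite lee_fin sqr_ge0.
- by rewrite lee_fin invr_ge0 sqr_ge0.
apply: ge0_le_integral => //.
- by apply/measurable_EFinP; exact: measurable_indic.
- exact: emeasurable_funM.
- move=> w _; rewrite -EFinM lee_fin indicE.
  case: (boolP (w \in _)) => [|_]; last by rewrite mulr_ge0 ?invr_ge0 ?sqr_ge0.
  rewrite inE/= => dW; rewrite ler_pdivlMl ?exprn_gt0// mulr1.
  by rewrite -(real_normK (num_real (W w))) lerXn2r ?nnegrE ?ltW// (lt_trans delta0).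
Qed.

(** * Mean square error of simple integrals *)

Section ito.
Context (d : measure_display) (T : measurableType d)
    (R : realType) (P : probability T R) (F : R -> set (set T)) (B : R -> T -> R).
Hypotheses (hF : complete_filtration P F) (hB : brownian_motion P F B).
Variable sigma : R -> R.
Hypothesis hsigma : {within `[0, +oo[, continuous sigma}.
Local Notation mu := lebesgue_measure.
Implicit Types (phi : simple_process F) (s t r : R) (w : T).

Lemma sp_time_ge0' phi k : 0 <= sp_time phi k.
Proof. by apply: le_trans (sp_time_ge0 phi) _; exact: sp_time_homo. Qed.

(** When [sp_time phi k >= t], the clipped interval shrinks to the point [t], while the coefficient
    may only be measurable later than [t]. Replacing it by zero keeps every coefficient measurable
    at its clipped left end point. *)
Definition sp_stop phi t k : T -> R :=
  if sp_time phi k < t then sp_coef phi k else fun=> 0.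

Let lo phi t k : R := Num.min t (sp_time phi k).

Lemma sp_stop_measurable phi t k : 0 <= t -> measurable_wrt (F (lo phi t k)) (sp_stop phi t k).
Proof.
move=> t0; rewrite /sp_stop /lo; case: (ltP (sp_time phi k) t) => h.
  exact: sp_coef_measurable.
by apply: measurable_wrt_cst; exact: filtration_sigma hF _ t0.
Qed.

Lemma sp_stop_bounded phi t k : bounded_rv (sp_stop phi t k).
Proof.
rewrite /sp_stop; case: ifP => _; first exact: sp_coef_bounded.
by exists 0 => w; rewrite normr0.
Qed.

Lemma sp_integral_stop phi t w : sp_integral B phi t w =
  \sum_(k < sp_size phi) sp_stop phi t k w * increment B (lo phi t k) (lo phi t k.+1) w.
Proof.
apply: eq_bigr => k _; rewrite /sp_stop /lo; case: (ltP (sp_time phi k) t) => // h.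
have h' : t <= sp_time phi k.+1 by apply: le_trans h _; exact: sp_time_homo.
by rewrite (min_idPl h') /increment subrr !mulr0.
Qed.

Lemma sp_value_stop phi t r w :
  \sum_(k < sp_size phi) sp_stop phi t k w * \1_`]lo phi t k, lo phi t k.+1] r =
  if r <= t then sp_value phi r w else 0.
Proof.
rewrite /sp_value; case: ifPn => rt; last first.
  apply: big1 => k _; rewrite indicE memNset ?mulr0//= in_itv/= le_min.
  by rewrite (negbTE rt) andbF.
apply: eq_bigr => k _; rewrite /sp_stop /lo; case: (ltP (sp_time phi k) t) => h.
  congr (_ * _); rewrite !indicE; congr (_%:R); congr nat_of_bool.
  by apply/idP/idP; rewrite !inE/= !in_itv/= le_min rt.
rewrite mul0r indicE memNset ?mulr0//= in_itv/= ltNge (le_trans rt h)//.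
Qed.

(** [sigma] is uncontrolled at negative times; its extension by zero is measurable on the whole
    line, as Tonelli requires. *)
Definition ext_sigma : R -> R := sigma \_ `[0, +oo[.

Lemma ext_sigmaE r : 0 <= r -> ext_sigma r = sigma r.
Proof. by move=> r0; rewrite /ext_sigma patchE mem_set//= in_itv/= r0. Qed.

Lemma measurable_ext_sigma : measurable_fun [set: R] ext_sigma.
Proof.
apply/(measurable_restrictT _ _).1 => //.
exact: subspace_continuous_measurable_fun.
Qed.

Definition sp_error phi t (z : T * measurableTypeR R) : \bar R :=
  ((sp_value phi z.2 z.1 - ext_sigma z.2) ^+ 2 * \1_`[0, t] z.2)%:E.

Lemma measurable_sp_error phi t : measurable_fun setT (sp_error phi t).
Proof.
apply/measurable_EFinP; apply: measurable_funM; last first.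
  by apply: (measurableT_comp (f:=\1_`[0, t] : measurableTypeR R -> R)).
apply: measurable_funX; apply: measurable_funB; last first.
  by apply: (measurableT_comp (f:=ext_sigma)) => //; exact: measurable_ext_sigma.
apply: measurable_sum => k; apply: measurable_funM; last first.
  by apply: (measurableT_comp (f:=\1_`]sp_time phi k, sp_time phi k.+1] : measurableTypeR R -> R)).
apply: (measurableT_comp (f:=sp_coef phi k)) => //.
apply: (@measurable_wrt_measurable _ _ _ (F (sp_time phi k))).
  exact: filtration_measurable hF _ (sp_time_ge0' _ _).
exact: sp_coef_measurable.
Qed.

Lemma sp_error_ge0 phi t z : (0 <= sp_error phi t z)%E.
Proof. by rewrite lee_fin mulr_ge0 ?sqr_ge0. Qed.

Lemma integral_sp_error phi t w :
  (\int[mu]_r sp_error phi t (w, r) =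
   \int[mu]_(r in `[0%R, t]) ((sp_value phi r w - sigma r) ^+ 2)%:E)%E.
Proof.
rewrite [RHS]integral_mkcond; apply: eq_integral => r _.
rewrite patchE /sp_error/= indicE; case: ifPn => //.
  rewrite inE/= in_itv/= => /andP[r0 rt].
  by rewrite ext_sigmaE// mulr1.
by rewrite mulr0.
Qed.

Lemma measurable_integral_sp_error phi t :
  measurable_fun setT (fun w => \int[mu]_r sp_error phi t (w, r))%E.
Proof.
apply: (measurable_fun_fubini_tonelli_F (m2 := mu) (sp_error phi t)).
  exact: measurable_sp_error.
exact: sp_error_ge0.
Qed.

Lemma sp_value_le0 phi r w : r <= 0 -> sp_value phi r w = 0.
Proof.
move=> r0; apply: big1 => k _; rewrite indicE memNset ?mulr0//= in_itv/=.
by rewrite ltNge (le_trans r0) ?sp_time_ge0'.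
Qed.

Lemma measurable_sp_error2 phi t w :
  measurable_fun [set: measurableTypeR R] (fun r => sp_error phi t (w, r)).
Proof.
apply: measurableT_comp; first exact: measurable_sp_error.
exact: pair1_measurable.
Qed.

Lemma sp_integral_measurable phi t : 0 <= t -> measurable_fun setT (sp_integral B phi t).
Proof.
move=> t0; have lo0 k : 0 <= lo phi t k by rewrite le_min t0 sp_time_ge0'.
rewrite (_ : sp_integral B phi t = fun w => \sum_(k < sp_size phi) sp_stop phi t k w *
    increment B (lo phi t k) (lo phi t k.+1) w); last first.
  by apply/funext => w; exact: sp_integral_stop.
apply: measurable_sum => k; apply: measurable_funM.
  apply: (@measurable_wrt_measurable _ _ _ (F (lo phi t k))).
    exact: filtration_measurable hF _ (lo0 k).
  exact: sp_stop_measurable.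
apply: (increment_measurable hF hB) => //.
by rewrite le_min ge_min lexx/= ge_min sp_time_homo// orbT.
Qed.

(* [is_ito_integral] allows random simple processes; the isometry lets us trade
   them for deterministic step functions, whose integrals have explicit laws. *)
Lemma sp_integral_step_error phi phi' s t (N : nat) (c u : nat -> R) (eta : R) (W : T -> R) :
  0 <= s -> s <= t ->
  (forall j, s <= u j) -> (forall j, u j <= u j.+1) -> (forall j, (j < N)%N -> u j.+1 <= t) ->
  (forall r, s < r -> r <= t ->
     `|sigma r - \sum_(j < N) c j * \1_`]u j, u j.+1] r| <= eta) ->
  (forall w, W w = sp_integral B phi t w - sp_integral B phi' s w -
             \sum_(j < N) c j * increment B (u j) (u j.+1) w) ->
  (\int[P]_w (W w ^+ 2)%:E <= (normal_m2 R * 3)%:E *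
   (\int[P]_w \int[mu]_r sp_error phi t (w, r) +
    \int[P]_w \int[mu]_r sp_error phi' s (w, r) + (eta ^+ 2 * (t - s))%:E))%E.
Proof.
move=> s0 st su uu ut hc hW.
have t0 : 0 <= t by lra.
(* A disjoint union of index types presents [W], a combination of three integrals, as one sum to
   which the isometry applies. *)
pose I := ('I_(sp_size phi) + ('I_(sp_size phi') + 'I_N))%type.
pose e (i : I) : T -> R := match i with
  | inl k => sp_stop phi t k
  | inr (inl k) => fun w => - 1 * sp_stop phi' s k w
  | inr (inr j) => fun=> - c j end.
pose a (i : I) : R := match i with
  | inl k => lo phi t k | inr (inl k) => lo phi' s k | inr (inr j) => u j end.
pose b (i : I) : R := match i with
  | inl k => lo phi t k.+1 | inr (inl k) => lo phi' s k.+1 | inr (inr j) => u j.+1 end.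
have lo0 phi0 t1 k : 0 <= t1 -> 0 <= lo phi0 t1 k.
  by move=> t10; rewrite le_min t10 sp_time_ge0'.
have lole phi0 t1 k : lo phi0 t1 k <= lo phi0 t1 k.+1.
  by rewrite le_min ge_min lexx/= ge_min sp_time_homo// orbT.
have a0 i : 0 <= a i.
  by case: i => [k|[k|j]]; [exact: lo0|exact: lo0|exact: le_trans (su _)].
have ab i : a i <= b i by case: i => [k|[k|j]]; [exact: lole|exact: lole|exact: uu].
have me i : measurable_wrt (F (a i)) (e i).
  have sF : sigma_algebra setT (F (a i)) by exact: filtration_sigma hF _ (a0 i).
  case: i sF => [k|[k|j]] sF.
  - exact: sp_stop_measurable.
  - by apply: measurable_wrtM => //; [exact: measurable_wrt_cst|exact: sp_stop_measurable].
  - exact: measurable_wrt_cst.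
have be i : bounded_rv (e i).
  case: i => [k|[k|j]].
  - exact: sp_stop_bounded.
  - have [M hM] := sp_stop_bounded phi' s k.
    by exists M => w; rewrite /e/= mulN1r normrN.
  - by exists `|c j| => w; rewrite /e normrN.
have [m [hm1 hm2]] := ito_isometry hF hB a0 ab me be.
have WE w : W w = \sum_i e i w * increment B (a i) (b i) w.
  rewrite !big_sumType/= hW !sp_integral_stop -!addrA; congr (_ + _).
  rewrite -!sumrN; congr (_ + _); apply: eq_bigr => k _; ring.
have -> : (\int[P]_w (W w ^+ 2)%:E = (normal_m2 R * m)%:E)%E.
  by under eq_integral do rewrite WE; exact: hm1.2.
rewrite (EFinM (normal_m2 R) m) (EFinM (normal_m2 R) 3) -muleA.
apply: lee_wpmul2l; first by rewrite lee_fin normal_m2_ge0.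
rewrite -hm2.
pose psi r := \sum_(j < N) c j * \1_`]u j, u j.+1] r.
have psi0 r : r <= s \/ t < r -> psi r = 0.
  move=> h; apply: big1 => j _; rewrite indicE memNset ?mulr0//= in_itv/=.
  move=> /andP[h1 h2]; have := su j; have := ut j (ltn_ord j); case: h; lra.
have EVE r w : \sum_i e i w * \1_`]a i, b i] r =
   (if r <= t then sp_value phi r w else 0) -
   (if r <= s then sp_value phi' r w else 0) - psi r.
  rewrite !big_sumType/= -!sp_value_stop -!addrA; congr (_ + _).
  rewrite -!sumrN; congr (_ + _); apply: eq_bigr => k _; ring.
have sq3 (x y : R) : (x + y) ^+ 2 <= 3 * (x ^+ 2 + y ^+ 2).
  by have := sqr_ge0 (x - y); have := sqr_ge0 x; have := sqr_ge0 y; nra.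
(* Up to [s], [sigma] cancels between the errors of [phi] and [phi']; on []s, t]] it cancels between
   the error of [phi] and that of the step function. At each time only two errors meet, which is why
   [sq3] has two arguments. *)
have pw r w : (((\sum_i e i w * \1_`]a i, b i] r) ^+ 2)%:E <=
   3%:E * (sp_error phi t (w, r) + sp_error phi' s (w, r) +
    (eta ^+ 2 * \1_`]s, t] r)%:E))%E.
  rewrite EVE /sp_error/= -!EFinD -EFinM lee_fin !indicE.
  have [r0|r0] := leP r 0.
    rewrite psi0; last by left; lra.
    rewrite !sp_value_le0// !if_same !subrr expr0n/=.
    by rewrite mulr_ge0// !addr_ge0// mulr_ge0// sqr_ge0.
  have [rs|sr] := leP r s.
    have rt : r <= t by lra.
    rewrite rt psi0; last by left.
    rewrite (mem_set (A := `[0, t]%classic)) /= ?in_itv/= ?(ltW r0)//.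
    rewrite (mem_set (A := `[0, s]%classic)) /= ?in_itv/= ?(ltW r0)//.
    rewrite subr0 !mulr1.
    have := sq3 (sp_value phi r w - ext_sigma r) (- (sp_value phi' r w - ext_sigma r)).
    rewrite sqrrN.
    have : 0 <= eta ^+ 2 * (r \in `]s, t]%classic)%:R by rewrite mulr_ge0 ?sqr_ge0.
    rewrite (_ : sp_value phi r w - ext_sigma r - (sp_value phi' r w - ext_sigma r) =
      sp_value phi r w - sp_value phi' r w); last by ring.
    by lra.
  have [rt|tr] := leP r t; last first.
    rewrite psi0; last by right.
    by rewrite !subrr expr0n/= mulr_ge0// !addr_ge0// mulr_ge0// sqr_ge0.
  rewrite (mem_set (A := `[0, t]%classic)) /= ?in_itv/= ?(ltW r0)//.
  rewrite (mem_set (A := `]s, t]%classic)) /= ?in_itv/= ?sr//.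
  rewrite subr0 !mulr1.
  have := hc r sr rt; rewrite -/(psi r) => hpsi.
  have : (sigma r - psi r) ^+ 2 <= eta ^+ 2.
    have e0 : 0 <= eta by apply: le_trans hpsi.
    by rewrite -(real_normK (num_real (sigma r - psi r))) lerXn2r ?nnegrE.
  have := sq3 (sp_value phi r w - ext_sigma r) (sigma r - psi r).
  rewrite (ext_sigmaE (ltW r0)) addrA subrK.
  have : 0 <= (sp_value phi' r w - sigma r) ^+ 2 * (r \in `[0, s]%classic)%:R.
    by rewrite mulr_ge0 ?sqr_ge0.
  by lra.
have i3 : (\int[mu]_r (eta ^+ 2 * \1_`]s, t] r)%:E = (eta ^+ 2 * (t - s))%:E)%E.
  under eq_integral do rewrite EFinM.
  rewrite ge0_integralZl//; last 2 first.
  - by apply/measurable_EFinP; exact: measurable_indic.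
  - by rewrite lee_fin sqr_ge0.
  rewrite integral_indic// setIT [RHS]EFinM; congr (_ * _)%E.
  rewrite [LHS]lebesgue_measure_itv/= lte_fin; case: ltP => // ts.
  by have -> : s = t; [apply/eqP; rewrite eq_le st ts|rewrite subrr].
have m3 : measurable_fun [set: measurableTypeR R] (fun r => (eta ^+ 2 * \1_`]s, t] r)%:E).
  by apply/measurable_EFinP; apply: measurable_funM => //; exact: measurable_indic.
have e30 r : (0 <= (eta ^+ 2 * \1_`]s, t] r)%:E)%E by rewrite lee_fin mulr_ge0 ?sqr_ge0.
set q1 := fun w => (\int[mu]_r sp_error phi t (w, r))%E.
set q2 := fun w => (\int[mu]_r sp_error phi' s (w, r))%E.
have q10 w : (0 <= q1 w)%E by apply: integral_ge0 => r _; exact: sp_error_ge0.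
have q20 w : (0 <= q2 w)%E by apply: integral_ge0 => r _; exact: sp_error_ge0.
have mq1 : measurable_fun setT q1 by exact: measurable_integral_sp_error.
have mq2 : measurable_fun setT q2 by exact: measurable_integral_sp_error.
have c0 : (0 <= (eta ^+ 2 * (t - s))%:E)%E by rewrite lee_fin mulr_ge0 ?sqr_ge0 ?subr_ge0.
have inner w : (\int[mu]_r ((\sum_i e i w * \1_`]a i, b i] r) ^+ 2)%:E <=
    3%:E * (q1 w + q2 w + (eta ^+ 2 * (t - s))%:E))%E.
  rewrite -i3 /q1 /q2 -!ge0_integralD//; try exact: measurable_sp_error2;
    try (by move=> r _; exact: sp_error_ge0);
    try (by move=> r _; apply: adde_ge0; exact: sp_error_ge0);
    try (by apply: emeasurable_funD; exact: measurable_sp_error2).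
  rewrite -ge0_integralZl//; last 2 first.
  - by apply: emeasurable_funD => //; apply: emeasurable_funD; exact: measurable_sp_error2.
  - by move=> r _; apply: adde_ge0 => //; apply: adde_ge0; exact: sp_error_ge0.
  apply: ge0_le_integral => //.
  - by move=> r _; rewrite lee_fin sqr_ge0.
  - apply/measurable_EFinP; apply: measurable_funX; apply: measurable_sum => i.
    by apply: measurable_funM => //; exact: measurable_indic.
  - apply: emeasurable_funM => //; apply: emeasurable_funD => //.
    by apply: emeasurable_funD; exact: measurable_sp_error2.
have -> : (3%:E * (\int[P]_w q1 w + \int[P]_w q2 w + (eta ^+ 2 * (t - s))%:E) =
    \int[P]_w (3%:E * (q1 w + q2 w + (eta ^+ 2 * (t - s))%:E)))%E.
  rewrite ge0_integralZl//; last 2 first.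
  - by apply: emeasurable_funD => //; exact: emeasurable_funD.
  - by move=> w _; apply: adde_ge0 => //; exact: adde_ge0.
  have q12 : measurable_fun setT (fun w => q1 w + q2 w)%E by exact: emeasurable_funD.
  have q120 w : (0 <= q1 w + q2 w)%E by exact: adde_ge0.
  rewrite (ge0_integralD P measurableT (fun w _ => q120 w) q12 (fun w _ => c0))//.
  rewrite (ge0_integralD P measurableT (fun w _ => q10 w) mq1 (fun w _ => q20 w) mq2).
  by rewrite integral_cst//= probability_setT mule1.
apply: ge0_le_integral => //.
- by move=> w _; apply: integral_ge0 => r _; rewrite lee_fin sqr_ge0.
- apply: (measurable_fun_fubini_tonelli_F (m2 := mu) (fun z : T * measurableTypeR R =>
     ((\sum_i e i z.1 * \1_`]a i, b i] z.2) ^+ 2)%:E)).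
    apply/measurable_EFinP; apply: measurable_funX; apply: measurable_sum => i.
    apply: measurable_funM.
      apply: (measurableT_comp (f := e i)) => //.
      apply: (@measurable_wrt_measurable _ _ _ (F (a i))) => //.
      exact: filtration_measurable hF _ (a0 i).
    by apply: (measurableT_comp (f:=\1_`]a i, b i] : measurableTypeR R -> R)).
  by move=> z; rewrite lee_fin sqr_ge0.
- by apply: emeasurable_funM => //; apply: emeasurable_funD => //; exact: emeasurable_funD.
Qed.

End ito.

(** * Tails from exponential moments *)

Section mgf_approx.
Context d (T : measurableType d) (R : realType) (P : probability T R).
Implicit Types (A : set T) (S D : T -> R) (v x l : R).

(** For [A] ranging over a sigma-algebra, this says that the conditional exponential moments of [S]
    are those of a centred Gaussian of variance [v]. *)
Definition has_mgf A S v := forall l,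
  (\int[P]_w (\1_A w * expR (l * S w))%:E = P A * (expR (l ^+ 2 * v / 2))%:E)%E.

Lemma measurable_gt S x : measurable_fun setT S -> measurable [set w | x < S w].
Proof.
move=> mS; rewrite -[X in measurable X]setTI.
exact: measurable_fun_ltr.
Qed.

(** Chernoff's bound at the optimal [l = x / v']; enlarging [v] to a positive [v'] covers
    [v = 0]. *)
Lemma upper_tail_mgf A S v v' x : measurable A -> measurable_fun setT S ->
  has_mgf A S v -> v <= v' -> 0 < v' -> 0 < x ->
  (P (A `&` [set w | x < S w]%R) <= P A * (expR (- (x ^+ 2 / (2 * v'))))%:E)%E.
Proof.
move=> mA mS hS vv' v'0 x0.
pose l := x / v'.
have l0 : 0 < l by rewrite divr_gt0.
have mE : measurable (A `&` [set w | x < S w]%R).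
  by apply: measurableI => //; exact: measurable_gt.
have mexp : measurable_fun setT (fun w => (\1_A w * expR (l * S w))%:E).
  apply/measurable_EFinP; apply: measurable_funM; first exact: measurable_indic.
  by apply: measurableT_comp => //; exact: measurable_funM.
have : (P (A `&` [set w | x < S w]%R) <= (expR (- (l * x)))%:E *
    \int[P]_w (\1_A w * expR (l * S w))%:E)%E.
  rewrite -[X in P X]setIT -integral_indic//= -ge0_integralZl//.
  apply: ge0_le_integral => //.
  - by apply/measurable_EFinP; exact: measurable_indic.
  - exact: emeasurable_funM.
  - move=> w _; rewrite -EFinM lee_fin !indicE in_setI.
    case: (w \in A) => /=; last by rewrite mul0r mulr0.
    rewrite mul1r; case: (boolP (w \in _)) => [|_]; last first.
      by rewrite mulr_ge0// expR_ge0.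
    rewrite inE/= => xS; rewrite -expRD -[leLHS]expR0 ler_expR.
    by rewrite addrC -mulrBr mulr_ge0 ?ltW ?subr_gt0.
move=> /le_trans; apply; rewrite hS muleCA -EFinM -expRD.
apply: lee_wpmul2l => //; rewrite lee_fin ler_expR.
have -> : - (x ^+ 2 / (2 * v')) = - (l * x) + l ^+ 2 * v' / 2.
  by rewrite /l; field; rewrite gt_eqF.
by rewrite lerD2l ler_wpM2r// ler_wpM2l// sqr_ge0.
Qed.

(* A Paley-Zygmund argument for [Y = expR (l * S)], whose mean [mu] and second
   moment [mu ^+ 4] are both known. *)
Lemma lower_tail_mgf A S v x l : measurable A -> measurable_fun setT S ->
  has_mgf A S v -> 0 < l -> x <= l * v / 2 - l^-1 ->
  (P A * (4^-1 * expR (- (l ^+ 2 * v)))%:E <= P (A `&` [set w | x < S w]%R))%E.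
Proof.
move=> mA mS hS l0 hx.
pose mu := expR (l ^+ 2 * v / 2).
have mu0 : 0 < mu by exact: expR_gt0.
have mE : measurable (A `&` [set w | x < S w]%R).
  by apply: measurableI => //; exact: measurable_gt.
have mexp k : measurable_fun setT (fun w => (\1_A w * expR (k * S w))%:E).
  apply/measurable_EFinP; apply: measurable_funM; first exact: measurable_indic.
  by apply: measurableT_comp => //; exact: measurable_funM.
have exp1 : expR (-1) <= 2^-1 :> R.
  rewrite expRN lef_pV2 ?posrE ?expR_gt0//.
  by have := @expR_ge1Dx R 1; lra.
pose E := A `&` [set w | x < S w]%R.
(* Off the event, the condition on [x] gives [Y <= mu * expR (-1) <= mu / 2]; on it, the bound is
   the arithmetic-geometric mean inequality. Since [Y ^+ 2] has mean [mu ^+ 4], the first two terms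
   use up three quarters of [mu * P A], and the last quarter is at most [mu ^+ 3 * P E]. *)
have pw w : \1_A w * expR (l * S w) <= (mu / 2) * \1_A w +
    ((4 * mu ^+ 3)^-1 * (\1_A w * expR (2 * l * S w)) + mu ^+ 3 * \1_E w).
  rewrite !indicE /E in_setI; case: (w \in A) => /=; last first.
    by rewrite !(mul0r, mulr0, addr0).
  rewrite !mul1r mulr1 -mulrA mulr_natl expRM_natl.
  set Y := expR (l * S w); have Y0 : 0 < Y by exact: expR_gt0.
  have mu3 : 0 < mu ^+ 3 by rewrite exprn_gt0.
  have Y2 : 0 <= (4 * mu ^+ 3)^-1 * Y ^+ 2.
    by rewrite mulr_ge0 ?sqr_ge0// invr_ge0 mulr_ge0// ltW.
  case: (boolP (w \in _)) => [_|]; last first.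
    rewrite notin_setE/= => /negP; rewrite -leNgt => Sx; rewrite mulr0 addr0.
    suff : Y <= mu / 2 by lra.
    have : Y <= mu * expR (-1).
      rewrite /Y /mu -expRD ler_expR.
      have : l * S w <= l * (l * v / 2 - l^-1).
        by rewrite ler_pM2l//; lra.
      by rewrite mulrBr divff ?gt_eqF// expr2; lra.
    move=> /le_trans; apply; rewrite ler_pM2l//.
  rewrite mulr1.
  have : Y <= (4 * mu ^+ 3)^-1 * Y ^+ 2 + mu ^+ 3.
    have -> : (4 * mu ^+ 3)^-1 * Y ^+ 2 + mu ^+ 3 =
        Y + (Y - 2 * mu ^+ 3) ^+ 2 / (4 * mu ^+ 3).
      by field; rewrite gt_eqF.
    by rewrite lerDl divr_ge0 ?sqr_ge0// mulr_ge0// ltW.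
  by lra.
have mind (C : set T) : measurable C -> measurable_fun setT (fun w => (\1_C w : R)%:E).
  by move=> mC; apply/measurable_EFinP; exact: measurable_indic.
have le_int : (\int[P]_w (\1_A w * expR (l * S w))%:E <=
    (mu / 2)%:E * P A + ((4 * mu ^+ 3)^-1%:E *
    \int[P]_w (\1_A w * expR (2 * l * S w))%:E + (mu ^+ 3)%:E * P E))%E.
  have c1 : (0 <= (mu / 2)%:E)%E by rewrite lee_fin divr_ge0// ltW.
  have c2 : (0 <= (4 * mu ^+ 3)^-1%:E)%E.
    by rewrite lee_fin invr_ge0 mulr_ge0// exprn_ge0// ltW.
  have c3 : (0 <= (mu ^+ 3)%:E)%E by rewrite lee_fin exprn_ge0// ltW.
  rewrite -[in P A](setIT A) -[in P E](setIT E) -!integral_indic//.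
  rewrite -!ge0_integralZl//; try exact: mind; try exact: mexp.
  have m1 : measurable_fun setT (fun w => (mu / 2)%:E * (\1_A w)%:E)%E.
    by apply: emeasurable_funM => //; exact: mind.
  have m2 : measurable_fun setT (fun w => (4 * mu ^+ 3)^-1%:E *
      (\1_A w * expR (2 * l * S w))%:E)%E by exact: emeasurable_funM.
  have m3 : measurable_fun setT (fun w => (mu ^+ 3)%:E * (\1_E w)%:E)%E.
    by apply: emeasurable_funM => //; exact: mind.
  have g1 w : (0 <= (mu / 2)%:E * (\1_A w)%:E)%E by rewrite mule_ge0.
  have g2 w : (0 <= (4 * mu ^+ 3)^-1%:E * (\1_A w * expR (2 * l * S w))%:E)%E.
    by rewrite mule_ge0// lee_fin mulr_ge0// expR_ge0.
  have g3 w : (0 <= (mu ^+ 3)%:E * (\1_E w)%:E)%E by rewrite mule_ge0.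
  rewrite -ge0_integralD// -ge0_integralD//; last 2 first.
  - by move=> w _; rewrite adde_ge0.
  - exact: emeasurable_funD.
  apply: ge0_le_integral => //.
  - by apply: emeasurable_funD => //; exact: emeasurable_funD.
  - by move=> w _; rewrite -!EFinM -!EFinD lee_fin; exact: pw.
move: le_int; rewrite !hS.
have PAE : P A = (fine (P A))%:E by rewrite fineK// fin_num_measure.
have PEE : P E = (fine (P E))%:E by rewrite fineK// fin_num_measure.
rewrite PAE PEE -!EFinM -!EFinD !lee_fin.
set a := fine (P A); set e := fine (P E).
have -> : expR ((2 * l) ^+ 2 * v / 2) = mu ^+ 4.
  by rewrite -expRM_natl; congr expR; field.
have -> : expR (- (l ^+ 2 * v)) = (mu ^+ 2)^-1.
  by rewrite -expRM_natl -expRN; congr expR; field.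
rewrite -/mu => h.
have h' : a * mu <= 4 * mu ^+ 3 * e.
  have e1 : (4 * mu ^+ 3)^-1 * (a * mu ^+ 4) = a * mu / 4.
    by field; rewrite gt_eqF.
  by move: h; rewrite e1; lra.
have -> : a * (4^-1 / mu ^+ 2) = a * mu / (4 * mu ^+ 3).
  by field; rewrite gt_eqF.
by rewrite ler_pdivrMr ?mulr_gt0 ?exprn_gt0// [leRHS]mulrC.
Qed.

(** [S] is close to [D] in probability only, which mean square convergence provides, so exponential
    moments never have to pass to the limit. Tails still transfer: a deviation of at most [delta]
    just shifts the level. *)
Definition mgf_approx (G : set (set T)) D v := forall delta, 0 < delta ->
  exists S V, [/\ measurable_fun setT S,
    (P [set w | delta < `|S w - D w|]%R <= delta%:E)%E, `|V - v| <= delta &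
    forall A, G A -> has_mgf A S V].

Lemma mgf_approxN G D v : mgf_approx G D v -> mgf_approx G (fun w => - D w) v.
Proof.
move=> h delta /h[S [V [mS SD Vv hS]]]; exists (fun w => - S w), V; split => //.
- exact: measurableT_comp.
- by under eq_set do rewrite -opprD normrN.
- move=> A GA l; rewrite -sqrrN -(hS A GA (- l)).
  by apply: eq_integral => w _; rewrite mulrN mulNr.
Qed.

Lemma measurable_abs_gt S x : measurable_fun setT S -> measurable [set w | x < `|S w|].
Proof. by move=> mS; apply: measurable_gt; exact: measurableT_comp. Qed.

(** Half of [x] pays for the approximation, which turns [2 * v'] into [8 * v']; the gap between [v]
    and [v'] absorbs the error in the variance. *)
Lemma upper_tail (G : set (set T)) D v v' x A : G `<=` measurable ->
  measurable_fun setT D -> mgf_approx G D v -> v < v' -> 0 < v' -> 0 < x -> G A ->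
  (P (A `&` [set w | x < D w]%R) <= P A * (expR (- (x ^+ 2 / (8 * v'))))%:E)%E.
Proof.
move=> Gm mD happ vv' v'0 x0 GA; have mA := Gm _ GA.
apply/lee_addgt0Pr => e e0.
pose delta := Num.min e (Num.min (x / 2) (v' - v)).
have delta0 : 0 < delta by rewrite !lt_min e0 divr_gt0//= subr_gt0.
have [de dx dv] : [/\ delta <= e, delta <= x / 2 & delta <= v' - v].
  by split; rewrite /delta !ge_min lexx ?orbT.
have [S [V [mS SD Vv hS]]] := happ _ delta0.
have mx : measurable (A `&` [set w | x / 2 < S w]%R).
  by apply: measurableI => //; exact: measurable_gt.
have md : measurable [set w | delta < `|S w - D w|]%R.
  by apply: measurable_abs_gt; exact: measurable_funB.
apply: (@le_trans _ _ (P (A `&` [set w | x / 2 < S w]%R) +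
    P [set w | delta < `|S w - D w|]%R)%E).
  apply: le_trans (measureU2 _ _ _) => //.
  apply: le_measure; rewrite ?inE//.
  - by apply: measurableI => //; exact: measurable_gt.
  - exact: measurableU.
  - move=> w [Aw /= xD]; have [h|h] := ltP delta `|S w - D w|; [by right|left].
    by split => //=; move: h; rewrite ler_norml => /andP[]; lra.
apply: leeD; last by apply: le_trans SD _; rewrite lee_fin.
have -> : x ^+ 2 / (8 * v') = (x / 2) ^+ 2 / (2 * v').
  by field; rewrite gt_eqF.
apply: (@upper_tail_mgf A S V) => //; [exact: hS| |by rewrite divr_gt0].
by move: Vv; rewrite ler_norml => /andP[]; lra.
Qed.

Lemma lower_tail (G : set (set T)) D v x A : G `<=` measurable ->
  measurable_fun setT D -> mgf_approx G D v -> 0 < v -> 0 < x -> G A ->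
  (P A * (4^-1 * expR (- (256 * (x ^+ 2 / v + 1))))%:E <=
   P (A `&` [set w | x < D w]%R))%E.
Proof.
move=> Gm mD happ v0 x0 GA; have mA := Gm _ GA.
apply/lee_addgt0Pr => e e0.
pose delta := Num.min e (Num.min x (v / 2)).
have delta0 : 0 < delta by rewrite !lt_min e0 x0 divr_gt0.
have [de dx dv] : [/\ delta <= e, delta <= x & delta <= v / 2].
  by split; rewrite /delta !ge_min lexx ?orbT.
have [S [V [mS SD Vv hS]]] := happ _ delta0.
have mx : measurable (A `&` [set w | x < D w]%R).
  by apply: measurableI => //; exact: measurable_gt.
have md : measurable [set w | delta < `|S w - D w|]%R.
  by apply: measurable_abs_gt; exact: measurable_funB.
apply: (@le_trans _ _ (P (A `&` [set w | x < D w]%R) +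
    P [set w | delta < `|S w - D w|]%R)%E); last first.
  by apply: leeD => //; apply: le_trans SD _; rewrite lee_fin.
apply: (@le_trans _ _ (P (A `&` [set w | 2 * x < S w]%R))); last first.
  apply: le_trans (measureU2 _ _ _) => //.
  apply: le_measure; rewrite ?inE//.
  - by apply: measurableI => //; exact: measurable_gt.
  - exact: measurableU.
  - move=> w [Aw /= xS]; have [h|h] := ltP delta `|S w - D w|; [by right|left].
    by split => //=; move: h; rewrite ler_norml => /andP[]; lra.
pose q := Num.sqrt v.
have q0 : 0 < q by rewrite sqrtr_gt0.
have q2 : q ^+ 2 = v by rewrite sqr_sqrtr// ltW.
(* With [V >= v / 2] this gives [l * V / 2 >= 2 * (x + q)], while [l^-1 <= q], so the level [2 * x]
   is admissible. With [V <= 2 * v] the price [l ^+ 2 * V] is at most [128 * (x + q) ^+ 2 / v],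
   hence the [256]. *)
pose l := 8 * (x + q) / v.
have xq0 : 0 < x + q by lra.
have l0 : 0 < l by rewrite divr_gt0// mulr_gt0.
have [Vl Vu] : v / 2 <= V /\ V <= 2 * v.
  by move: Vv; rewrite ler_norml => /andP[]; lra.
have l1 : 2 * x <= l * V / 2 - l^-1.
  have : l * (v / 2) <= l * V by rewrite ler_pM2l.
  have -> : l * (v / 2) = 4 * (x + q) by rewrite /l; field; rewrite gt_eqF.
  have : l^-1 <= q.
    rewrite /l invf_div ler_pdivrMr ?mulr_gt0// -q2 expr2.
    by rewrite ler_pM2l//; lra.
  by lra.
have l2 : l ^+ 2 * V <= 256 * (x ^+ 2 / v + 1).
  apply: (@le_trans _ _ (l ^+ 2 * (2 * v))).
    by rewrite ler_wpM2l// sqr_ge0.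
  have -> : l ^+ 2 * (2 * v) = 128 * (x + q) ^+ 2 / v.
    by rewrite /l; field; rewrite gt_eqF.
  have -> : 256 * (x ^+ 2 / v + 1) = 256 * (x ^+ 2 + q ^+ 2) / v.
    by rewrite q2; field; rewrite gt_eqF.
  rewrite ler_pM2r ?invr_gt0//.
  by have := sqr_ge0 (x - q); nra.
apply: le_trans (lower_tail_mgf mA mS (hS A GA) l0 l1).
apply: lee_wpmul2l => //; rewrite lee_fin ler_wpM2l// ler_expR.
by rewrite lerN2.
Qed.

End mgf_approx.

(** * Uniform continuity and Riemann sums *)

Section real_analysis.
Context {R : realType}.
Local Notation mu := (@lebesgue_measure R).
Implicit Types (g : R -> R) (a b r : R).

(** Heine-Cantor, from the near-covering form of compactness applied to the filter of small positive
    radii. *)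
Lemma uniformly_continuous_compact g (K : set R) : compact K ->
  {within K, continuous g} -> forall eta : R, 0 < eta ->
  exists2 delta : R, 0 < delta &
    forall x y, K x -> K y -> `|x - y| < delta -> `|g x - g y| <= eta.
Proof.
move=> cK /subspace_continuousP cg eta eta0.
have /near_covering_withinP/(_ R (0^'+) (fun dl x => forall y, K y ->
    `|x - y| < dl -> `|g x - g y| <= eta)) := (compact_near_coveringP K).1 cK.
case.
- move=> x Kx; have := cg x Kx.
  move=> /cvgrPdist_lt /(_ (eta / 2)) /(_ ltac:(by rewrite divr_gt0)).
  rewrite near_withinE => /nbhs_ballP[e /= e0 he].
  exists (ball x (e / 2), [set dl : R | dl < e / 2]) => /=.
    split; first by apply: nbhsx_ballx; rewrite divr_gt0.
    by apply: nbhs_right_lt; rewrite divr_gt0.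
  move=> [x' dl] [/= xx' dle] Kx' y Ky x'y.
  have h1 : `|g x - g x'| < eta / 2.
    by apply: he => //; apply: le_ball xx'; lra.
  have h2 : `|g x - g y| < eta / 2.
    apply: he => //; rewrite /ball/= in xx' *.
    have -> : x - y = (x - x') + (x' - y) by ring.
    by apply: le_lt_trans (ler_normD _ _) _; lra.
  have -> : g x' - g y = (g x - g y) - (g x - g x') by ring.
  by apply: le_trans (ler_normB _ _) _; lra.
move=> e /= e0 he; exists (e / 2); first by rewrite divr_gt0.
move=> x y Kx Ky; apply: he => //=; last by rewrite divr_gt0.
by rewrite sub0r normrN gtr0_norm; lra.
Qed.

(** [J] has the shape obtained by subtracting the integral equation at two times. Bounds are asked
    on []a, b]] only, which is where a crossing or a step function supplies them. *)
Lemma Rintegral_increment_bounds g (a0 a b m M : R) : a0 <= a -> a <= b ->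
  {within `[a0, b], continuous g} ->
  let J := \int[mu]_(r in `[a0, b]) g r - \int[mu]_(r in `[a0, a]) g r in
  ((forall r, a < r -> r <= b -> m <= g r) -> m * (b - a) <= J) /\
  ((forall r, a < r -> r <= b -> g r <= M) -> J <= M * (b - a)).
Proof.
move=> a0a ab cg J; rewrite /J.
have ig : mu.-integrable `[a0, b] (EFin \o g).
  by apply: continuous_compact_integrable => //; exact: segment_compact.
rewrite Rintegral_itvB//; try by rewrite bnd_simp.
have ig' : mu.-integrable `]a, b] (EFin \o g).
  apply: integrableS ig => // r /=; rewrite !in_itv/= => /andP[ar ->].
  by rewrite (le_trans a0a) ?ltW.
have icst c : mu.-integrable `]a, b] (EFin \o (fun=> c : R)).
  have icst' : mu.-integrable `[a, b] (EFin \o (fun=> c : R)).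
    apply: continuous_compact_integrable; first exact: segment_compact.
    by apply: continuous_subspaceT => x; exact: cvg_cst.
  apply: integrableS icst' => // r /=.
  by rewrite !in_itv/= => /andP[/ltW -> ->].
have cstE c : \int[mu]_(r in `]a, b]) c = c * (b - a).
  rewrite Rintegral_cst//=; congr (_ * _).
  rewrite lebesgue_measure_itv/= lte_fin; case: ltP => //= ba.
  by have -> : a = b; [apply/eqP; rewrite eq_le ab ba|rewrite subrr].
split=> h; rewrite -cstE; apply: le_Rintegral => // r /=;
  by rewrite in_itv/= => /andP[]; exact: h.
Qed.

(** One mesh serves two purposes: [sg] is nearly constant on each cell, for the isometry, and so is
    its square, whose Riemann sum is the variance of the step integral. *)
Lemma step_approx (sg : R -> R) (s t : R) : s < t -> {within `[s, t], continuous sg} ->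
  forall eta, 0 < eta -> exists N (u : nat -> R),
  [/\ u 0%N = s /\ u N = t, forall j, s <= u j, forall j, u j <= u j.+1,
   (forall r, s < r -> r <= t ->
     `|sg r - \sum_(j < N) sg (u j) * \1_`]u j, u j.+1] r| <= eta) &
   `|\sum_(j < N) sg (u j) ^+ 2 * (u j.+1 - u j) -
     \int[mu]_(r in `[s, t]) (sg r ^+ 2)| <= eta * (t - s)].
Proof.
move=> st csg eta eta0.
have csg2 : {within `[s, t], continuous (fun r => sg r ^+ 2)}.
  move=> r; apply: (@continuous_comp _ _ _ (sg : subspace _ -> R) (fun y : R => y ^+ 2)).
    exact: csg.
  exact: sqr_continuous.
have cK : compact `[s, t] by exact: segment_compact.
have [d1 d10 hd1] := uniformly_continuous_compact cK csg eta0.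
have [d2 d20 hd2] := uniformly_continuous_compact cK csg2 eta0.
pose dl := Num.min d1 d2.
have dl0 : 0 < dl by rewrite lt_min d10.
have := archi_boundP (ltW (divr_gt0 (_ : 0 < t - s) dl0)); rewrite subr_gt0 => /(_ st).
set N := Num.bound _ => hN.
have N0 : 0 < N%:R :> R by apply: lt_trans hN; rewrite divr_gt0// subr_gt0.
pose h := (t - s) / N%:R.
have h0 : 0 < h by rewrite divr_gt0// subr_gt0.
have hdl : h < dl by rewrite ltr_pdivrMr// mulrC -ltr_pdivrMr.
pose u j : R := s + j%:R * h.
have uS j : u j.+1 = u j + h by rewrite /u -natr1; ring.
have uN : u N = t by rewrite /u /h; field; rewrite gt_eqF.
have su j : s <= u j by rewrite lerDl mulr_ge0// ltW.
have uu j : u j <= u j.+1 by rewrite uS lerDl ltW.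
have umono i j : (i <= j)%N -> u i <= u j.
  by move=> ij; rewrite lerD2l ler_pM2r// ler_nat.
have ut j : (j < N)%N -> u j.+1 <= t by move=> jN; rewrite -uN; exact: umono.
have close j r : (j < N)%N -> u j < r -> r <= u j.+1 ->
    `|sg r - sg (u j)| <= eta /\ `|sg r ^+ 2 - sg (u j) ^+ 2| <= eta.
  move=> jN ur ru; have := su j; have := ut j jN => h1 h2.
  have Kr : `[s, t]%classic r by rewrite /= in_itv/=; apply/andP; split; lra.
  have Ku : `[s, t]%classic (u j) by rewrite /= in_itv/=; apply/andP; split; lra.
  have : `|r - u j| < dl.
    by rewrite ger0_norm; move: ru; rewrite uS; lra.
  by rewrite lt_min => /andP[? ?]; split; [apply: hd1|apply: hd2].
exists N, u; split => //; first by split=> //; rewrite /u mul0r addr0.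
- move=> r sr rt.
  have indE j : \1_`]u j, u j.+1] r = (r <= u j.+1)%R%:R - (r <= u j)%R%:R :> R.
    rewrite indicE; have [ru|ur] := leP r (u j).
      by rewrite (le_trans ru (uu j)) subrr memNset//= in_itv/= ltNge ru.
    rewrite subr0; congr (_%:R); congr nat_of_bool.
    by apply/idP/idP; rewrite inE/= in_itv/= ur.
  have sum1 : \sum_(j < N) \1_`]u j, u j.+1] r = 1 :> R.
    under eq_bigr do rewrite indE.
    rewrite -(big_mkord xpredT (fun j => (r <= u j.+1)%R%:R - (r <= u j)%R%:R)).
    rewrite telescope_sumr// uN rt /u mul0r addr0.
    by rewrite leNgt sr subr0.
  rewrite -[sg r]mulr1 -sum1 mulr_sumr -sumrB.
  apply: le_trans (ler_norm_sum _ _ _) _.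
  apply: (@le_trans _ _ (\sum_(j < N) eta * \1_`]u j, u j.+1] r)); last first.
    by rewrite -mulr_sumr sum1 mulr1.
  apply: ler_sum => j _; rewrite -mulrBl normrM (ger0_norm (_ : 0 <= \1__ _))//.
  rewrite indicE; case: (boolP (r \in _)) => [|_]; last by rewrite !mulr0.
  rewrite inE/= in_itv/= !mulr1 => /andP[ur ru].
  by have [] := close j r (ltn_ord j) ur ru.
- suff key n : (n <= N)%N -> `|\sum_(j < n) sg (u j) ^+ 2 * (u j.+1 - u j) -
      \int[mu]_(r in `[s, u n]) (sg r ^+ 2)| <= eta * (u n - s).
    by have := key N (leqnn N); rewrite uN.
  elim: n => [_|n ih nN].
    rewrite big_ord0 /u mul0r addr0 subrr mulr0.
    by rewrite set_itv1 Rintegral_set1 subrr normr0.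
  have := ih (ltnW nN); rewrite big_ord_recr/=.
  have := @Rintegral_increment_bounds (fun r => sg r ^+ 2) s (u n) (u n.+1)
    (sg (u n) ^+ 2 - eta) (sg (u n) ^+ 2 + eta) (su n) (uu n).
  have ct : {within `[s, u n.+1], continuous (fun r => sg r ^+ 2)}.
    apply: continuous_subspaceW csg2 => r /=; rewrite !in_itv/= => /andP[-> h1].
    exact: le_trans (ut n nN).
  move=> /(_ ct); set I1 := \int[mu]_(_ in `[s, u n]) _.
  set I2 := \int[mu]_(_ in `[s, u n.+1]) _.
  have hb r : u n < r -> r <= u n.+1 -> sg (u n) ^+ 2 - eta <= sg r ^+ 2 <= sg (u n) ^+ 2 + eta.
    move=> ur ru; have [_] := close n r nN ur ru.
    by rewrite ler_norml => /andP[? ?]; apply/andP; split; lra.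
  move=> [/(_ (fun r ur ru => proj1 (andP (hb r ur ru)))) h1
    /(_ (fun r ur ru => proj2 (andP (hb r ur ru)))) h2]; move: h1 h2.
  rewrite !ler_norml => h1 h2 /andP[h3 h4].
  move: h1 h2; rewrite mulrBl mulrDl => h1 h2.
  by apply/andP; split; lra.
Qed.

End real_analysis.

(** * Increments of the Ito integral *)

Section ito_increment.
Context (d : measure_display) (T : measurableType d)
    (R : realType) (P : probability T R) (F : R -> set (set T)) (B : R -> T -> R).
Hypotheses (hF : complete_filtration P F) (hB : brownian_motion P F B).
Local Notation mu := (@lebesgue_measure R).

Section step_integral.
Variables (s : R) (c u : nat -> R).
Hypotheses (s0 : 0 <= s) (u0 : u 0%N = s) (uu : forall j, u j <= u j.+1).

Let S n w := \sum_(j < n) c j * increment B (u j) (u j.+1) w.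
Let V n := \sum_(j < n) c j ^+ 2 * (u j.+1 - u j).

Let su n : s <= u n.
Proof. by elim: n => [|n ih]; [rewrite u0|exact: le_trans (uu n)]. Qed.

Let u_ge0 n : 0 <= u n. Proof. exact: le_trans (su n). Qed.

Let measurable_wrt_step n : measurable_wrt (F (u n)) (S n).
Proof.
elim: n => [|n ih].
  rewrite (_ : S 0%N = fun=> 0); last by apply/funext => w; rewrite /S big_ord0.
  by apply: measurable_wrt_cst; exact: filtration_sigma hF _ (u_ge0 0).
have sF : sigma_algebra setT (F (u n.+1)) by exact: filtration_sigma hF _ (u_ge0 _).
rewrite (_ : S n.+1 = fun w => S n w - (- c n) * increment B (u n) (u n.+1) w); last first.
  by apply/funext => w; rewrite /S big_ord_recr/= mulNr opprK.
apply: measurable_wrtB => //.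
  by apply: measurable_wrt_sub ih; apply: (filtration_le hF).
apply: measurable_wrtM => //; first exact: measurable_wrt_cst.
exact: (increment_wrt hF hB).
Qed.

Lemma measurable_step n : measurable_fun setT (S n).
Proof.
apply: (@measurable_wrt_measurable _ _ _ (F (u n))) => //.
exact: filtration_measurable hF _ (u_ge0 n).
Qed.

(** The next Brownian increment is independent of [F (u n)], so it multiplies the exponential moment
    by its own Gaussian factor. Repeated nodes are set apart because the normal law of an increment
    is given for distinct times only. *)
Lemma has_mgf_step n A : F s A -> has_mgf P A (S n) (V n).
Proof.
move=> FA l.
have mA : measurable A by exact: filtration_measurable hF _ s0 _ FA.
have mind : measurable_fun setT (fun w => (\1_A w : R)%:E).
  by apply/measurable_EFinP; exact: measurable_indic.
elim: n => [|n ih].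
  rewrite /S /V big_ord0 mulr0 mul0r expR0 mule1.
  under eq_integral do rewrite big_ord0 mulr0 expR0 mulr1.
  by rewrite integral_indic// setIT.
have [uE|un] := eqVneq (u n) (u n.+1).
  have -> : V n.+1 = V n by rewrite /V big_ord_recr/= uE subrr mulr0 addr0.
  rewrite -ih; apply: eq_integral => w _.
  by rewrite /S big_ord_recr/= /increment uE subrr mulr0 addr0.
have ult : u n < u n.+1 by rewrite lt_neqAle un uu.
have sF : sigma_algebra setT (F (u n)) by exact: filtration_sigma hF _ (u_ge0 _).
pose Z w := \1_A w * expR (l * S n w).
have mZ : measurable_wrt (F (u n)) Z.
  apply: measurable_wrtM => //.
    by apply: measurable_wrt_indic => //; apply: (filtration_le hF s0 (su n)).
  apply/(measurable_wrtP _ sF); apply: measurableT_comp => //.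
  apply: measurable_funM => //; exact/(measurable_wrtP _ sF).
have q0 : 0 < Num.sqrt (u n.+1 - u n) by rewrite sqrtr_gt0 subr_gt0.
have mg : measurable_fun setT (fun x : measurableTypeR R => expR (l * c n * x)).
  by apply: measurableT_comp => //; exact: measurable_funM.
have := ge0_integral_indepM (filtration_measurable hF (u_ge0 n))
  (increment_measurable hF hB (u_ge0 n) (uu n))
  (fun C E FC mE => increment_indep hB (u_ge0 n) ult FC mE) mZ mg.
move=> /(_ (fun w => mulr_ge0 (_ : 0 <= \1_A w) (expR_ge0 _))) h.
have {}h := h (fun w => ltac:(by [])) (fun x => expR_ge0 _).
transitivity (\int[P]_w (Z w * expR (l * c n * increment B (u n) (u n.+1) w))%:E)%E.
  apply: eq_integral => w _; congr EFin.
  by rewrite /S big_ord_recr/= mulrDr expRD /Z !mulrA.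
rewrite h mgf_normal_prob// ih -muleA -EFinM -expRD; congr (_ * (expR _)%:E)%E.
rewrite sqr_sqrtr ?subr_ge0// /V big_ord_recr/=.
by ring.
Qed.

End step_integral.

Variable sigma : R -> R.
Hypothesis hsigma : {within `[0, +oo[, continuous sigma}.

(** The approximating sequences at [s] and at [t] are unrelated. Both are compared with one step
    integral over []s, t]], whose deterministic coefficients give it exact conditional exponential
    moments. *)
Lemma ito_mgf_approx s t Is It : 0 <= s -> s < t ->
  measurable_fun setT Is -> measurable_fun setT It ->
  is_ito_integral P F B sigma s Is -> is_ito_integral P F B sigma t It ->
  mgf_approx P (F s) (fun w => It w - Is w) (\int[mu]_(r in `[s, t]) (sigma r ^+ 2))%R.
Proof.
move=> s0 st mIs mIt [phi' [hq' hI']] [phi [hq hI]] delta delta0.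
have t0 : 0 <= t by lra.
(* By Chebyshev, a mean square of at most [rho] exceeds [delta / 3] with probability at most
   [rho / (delta / 3) ^+ 2 = delta / 3]; three such errors add up to [delta]. *)
pose rho : R := (delta / 3) ^+ 3.
have rho0 : 0 < rho by rewrite exprn_gt0// divr_gt0.
have k0 := @normal_m2_ge0 R.
(* Three errors of size [e] times the constant [normal_m2 R * 3] stay below [rho]; the added [9]
   keeps the denominator positive. *)
pose e : R := rho / (9 * normal_m2 R + 9).
have k9 : 0 < 9 * normal_m2 R + 9 by lra.
have e0 : 0 < e by rewrite divr_gt0.
(* [eta <= 1] brings [eta ^+ 2 * (t - s)] below [e], for the isometry; the bound by [delta] is for
   the variance. *)
pose eta : R := Num.min 1 (Num.min e delta / (t - s)).
have ts : 0 < t - s by rewrite subr_gt0.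
have eta0 : 0 < eta by rewrite lt_min ltr01 divr_gt0// lt_min e0.
have [eta1 etae etad] : [/\ eta <= 1, eta * (t - s) <= e & eta * (t - s) <= delta].
  have h : eta * (t - s) <= Num.min e delta.
    by rewrite -ler_pdivlMr// /eta ge_min lexx orbT.
  split; first by rewrite /eta ge_min lexx.
    by apply: le_trans h _; rewrite ge_min lexx.
  by apply: le_trans h _; rewrite ge_min lexx orbT.
have cst : {within `[s, t], continuous sigma}.
  apply: continuous_subspaceW hsigma => r /=; rewrite !in_itv/= andbT => /andP[sr _].
  exact: le_trans sr.
have [N [u [[u0 uN] su uu hu hV]]] := step_approx st cst eta0.
pose S w := \sum_(j < N) sigma (u j) * increment B (u j) (u j.+1) w.
exists S, (\sum_(j < N) sigma (u j) ^+ 2 * (u j.+1 - u j)); split.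
- exact: (measurable_step (fun j => sigma (u j)) s0 u0 uu).
- have ev0 (a : nat -> \bar R) (z : R) : 0 < z -> a n @[n --> \oo] --> 0%E ->
      \forall n \near \oo, (a n <= z%:E)%E.
    move=> z0 ha; apply: (ha [set x | (x <= z%:E)%E]); exists z => //= x.
    by rewrite /ball_/= sub0r normrN lee_fin => /ltW; exact/le_trans/ler_norm.
  have [n [h1 h2 h3 h4]] : exists n, [/\
    (\int[P]_w \int[mu]_(r in `[0%R, s]) ((sp_value (phi' n) r w - sigma r) ^+ 2)%:E <= e%:E)%E,
    (\int[P]_w ((sp_integral B (phi' n) s w - Is w) ^+ 2)%:E <= rho%:E)%E,
    (\int[P]_w \int[mu]_(r in `[0%R, t]) ((sp_value (phi n) r w - sigma r) ^+ 2)%:E <= e%:E)%E &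
    (\int[P]_w ((sp_integral B (phi n) t w - It w) ^+ 2)%:E <= rho%:E)%E].
    have [n1 _ E1] := ev0 _ _ e0 hq'; have [n2 _ E2] := ev0 _ _ rho0 hI'.
    have [n3 _ E3] := ev0 _ _ e0 hq; have [n4 _ E4] := ev0 _ _ rho0 hI.
    exists (maxn (maxn n1 n2) (maxn n3 n4)).
    by split; [apply: E1|apply: E2|apply: E3|apply: E4]; rewrite /= !leq_max leqnn ?orbT.
  have hut j : (j < N)%N -> u j.+1 <= t.
    rewrite -uN; elim: (N) => // m ih; rewrite ltnS leq_eqVlt => /predU1P[->//|].
    by move=> /ih /le_trans; apply.
  pose W w := sp_integral B (phi n) t w - sp_integral B (phi' n) s w - S w.
  have mphi : measurable_fun setT (sp_integral B (phi n) t).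
    exact: (sp_integral_measurable hF hB).
  have mphi' : measurable_fun setT (sp_integral B (phi' n) s).
    exact: (sp_integral_measurable hF hB).
  have mS : measurable_fun setT S.
    exact: (measurable_step (fun j => sigma (u j)) s0 u0 uu).
  have mW : measurable_fun setT W.
    by apply: measurable_funB => //; exact: measurable_funB.
  have hW : (\int[P]_w (W w ^+ 2)%:E <= rho%:E)%E.
    have step := @sp_integral_step_error _ _ _ _ _ _ hF hB _ hsigma (phi n) (phi' n) s t N
      (fun j => sigma (u j)) u eta W s0 (ltW st) su uu hut hu (fun w => erefl (W w)).
    apply: (le_trans step).
    apply: (@le_trans _ _ ((normal_m2 R * 3)%:E * (e%:E + e%:E + e%:E)%E)%E).
      apply: lee_wpmul2l; first by rewrite lee_fin mulr_ge0.
      apply: leeD; [apply: leeD|].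
      - apply: le_trans h3; rewrite le_eqVlt; apply/predU1P; left.
        by apply: eq_integral => w _; rewrite integral_sp_error.
      - apply: le_trans h1; rewrite le_eqVlt; apply/predU1P; left.
        by apply: eq_integral => w _; rewrite integral_sp_error.
      - rewrite lee_fin; apply: le_trans etae; rewrite ler_pM2r// expr2.
        by rewrite ler_piMl// ltW.
    rewrite -!EFinD -EFinM lee_fin.
    have -> : normal_m2 R * 3 * (e + e + e) = rho * (9 * normal_m2 R / (9 * normal_m2 R + 9)).
      by rewrite /e; field; rewrite gt_eqF.
    apply: ler_piMr; first exact: ltW.
    by rewrite ler_pdivrMr// mul1r; lra.
  have d3 : 0 < delta / 3 by rewrite divr_gt0.
  have cheb (X : T -> R) : measurable_fun setT X -> (\int[P]_w (X w ^+ 2)%:E <= rho%:E)%E ->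
      (P [set w | (delta / 3 < `|X w|)%R] <= (delta / 3)%:E)%E.
    move=> mX hX; apply: le_trans (chebyshev_sqr P mX d3) _.
    apply: (@le_trans _ _ (((delta / 3) ^- 2)%:E * rho%:E)%E).
      by apply: lee_wpmul2l => //; rewrite lee_fin invr_ge0 sqr_ge0.
    rewrite -EFinM lee_fin /rho le_eqVlt; apply/predU1P; left.
    by field; rewrite gt_eqF.
  have mI1 : measurable_fun setT (fun w => sp_integral B (phi n) t w - It w).
    exact: measurable_funB.
  have mI2 : measurable_fun setT (fun w => sp_integral B (phi' n) s w - Is w).
    exact: measurable_funB.
  have p1 := cheb _ mW hW; have p2 := cheb _ mI1 h4; have p3 := cheb _ mI2 h2.
  apply: (@le_trans _ _ (P ([set w | (delta / 3 < `|W w|)%R] `|`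
    ([set w | (delta / 3 < `|sp_integral B (phi n) t w - It w|)%R] `|`
    [set w | (delta / 3 < `|sp_integral B (phi' n) s w - Is w|)%R])))).
    apply: le_measure; rewrite ?inE.
    + by apply: measurable_abs_gt; apply: measurable_funB => //; exact: measurable_funB.
    + by do 2?[apply: measurableU]; exact: measurable_abs_gt.
    + move=> w /=; apply: contraPP => /not_orP[/negP + /not_orP[/negP + /negP]].
      rewrite -!leNgt => a1 a2 a3; apply/negP; rewrite -leNgt.
      have -> : S w - (It w - Is w) = - W w + (sp_integral B (phi n) t w - It w) -
        (sp_integral B (phi' n) s w - Is w) by rewrite /W; ring.
      apply: le_trans (ler_normB _ _) _; apply: le_trans (lerD (ler_normD _ _) (lexx _)) _.
      by rewrite normrN; lra.
  have -> : delta%:E = ((delta / 3)%:E + ((delta / 3)%:E + (delta / 3)%:E))%E.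
    by rewrite -!EFinD; congr EFin; field.
  apply: le_trans (measureU2 _ _ _) _ => //; try exact: measurable_abs_gt.
    by apply: measurableU; exact: measurable_abs_gt.
  apply: leeD => //; apply: le_trans (measureU2 _ _ _) _ => //; try exact: measurable_abs_gt.
  exact: leeD.
- exact: le_trans etad.
- move=> A FA; exact: (has_mgf_step (fun j => sigma (u j)) s0 u0 uu).
Qed.

End ito_increment.

(** * Probabilities as real numbers *)

Section real_probability.
Context d (T : measurableType d) (R : realType) (P : probability T R).
Implicit Types A C : set T.

Definition pr A : R := fine (P A).

Lemma prE A : measurable A -> P A = (pr A)%:E.
Proof. by move=> mA; rewrite /pr fineK// fin_num_measure. Qed.

Lemma pr_ge0 A : 0 <= pr A.
Proof. exact: fine_ge0. Qed.

Lemma pr_le1 A : measurable A -> pr A <= 1.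
Proof. by move=> mA; rewrite -lee_fin -prE// probability_le1. Qed.

Lemma le_pr A C : measurable A -> measurable C -> A `<=` C -> pr A <= pr C.
Proof. by move=> mA mC AC; rewrite -lee_fin -!prE// le_measure ?inE. Qed.

Lemma prU A C : measurable A -> measurable C -> A `&` C = set0 ->
  pr (A `|` C) = pr A + pr C.
Proof.
move=> mA mC AC; apply: EFin_inj; rewrite EFinD -!prE//; last exact: measurableU.
by rewrite measureU//; apply/eqP; rewrite AC.
Qed.

Lemma prU_le A C : measurable A -> measurable C -> pr (A `|` C) <= pr A + pr C.
Proof.
move=> mA mC; rewrite -lee_fin EFinD -!prE//; last exact: measurableU.
exact: measureU2.
Qed.

Lemma prID A C : measurable A -> measurable C ->
  pr A = pr (A `&` C) + pr (A `&` ~` C).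
Proof.
move=> mA mC; rewrite -prU.
- by rewrite -setIUr setUCr setIT.
- exact: measurableI.
- by apply: measurableI => //; exact: measurableC.
- by rewrite setIACA setICr !setI0.
Qed.

Lemma pr_bigcap_le (A : nat -> set T) (e : R) : (forall n, measurable (A n)) ->
  (exists n, pr (A n) <= e) -> pr (\bigcap_n A n) <= e.
Proof.
move=> mA [n hn]; apply: le_trans hn; apply: le_pr => //.
  exact: bigcap_measurable.
exact: bigcap_inf.
Qed.

Lemma pr_bigcup_le (A : nat -> set T) (e : R) : (forall n, measurable (A n)) ->
  nondecreasing_seq A -> (forall n, pr (A n) <= e) -> pr (\bigcup_n A n) <= e.
Proof.
move=> mA ndA hA; have mU : measurable (\bigcup_n A n) by exact: bigcup_measurable.
rewrite -lee_fin -prE//.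
have h := nondecreasing_cvg_mu (mu := P) mA mU ndA.
rewrite -(cvg_lim _ h)//; apply: lime_le; first by apply/cvg_ex; exists (P (\bigcup_n A n)).
by apply: nearW => n /=; rewrite prE// lee_fin.
Qed.

Lemma pr0_negligible A : measurable A -> pr A <= 0 -> P.-negligible A.
Proof.
move=> mA h; exists A; split => //; rewrite prE//; congr EFin.
by apply/eqP; rewrite eq_le h pr_ge0.
Qed.

Lemma pr_tail (Y : T -> R) (e : R) : measurable_fun setT Y -> 0 < e ->
  exists2 M : R, 0 < M & pr [set w | M < `|Y w|] <= e.
Proof.
move=> mY e0.
pose A n := [set w | n.+1%:R < `|Y w|].
have mA n : measurable (A n) by exact: measurable_abs_gt.
have A0 : \bigcap_n A n = set0.
  rewrite -subset0 => w /= hw.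
  have h0 := archi_boundP (normr_ge0 (Y w)).
  have := hw (Num.bound `|Y w|) I; rewrite /A/= ltNge => /negP; apply.
  by apply/ltW/(lt_trans h0); rewrite ltr_nat.
have h := @nonincreasing_cvg_mu _ _ _ P A.
have {}h : P (A n) @[n --> \oo] --> 0%E.
  rewrite -(measure0 P) -A0; apply: h => //.
  - by rewrite ltey_eq fin_num_measure.
  - exact: bigcap_measurable.
  - move=> m n mn; apply/subsetPset => w /=; apply: le_lt_trans.
    by rewrite ler_nat ltnS.
have [N _ hN] : \forall n \near \oo, (P (A n) <= e%:E)%E.
  apply: (h [set x | (x <= e%:E)%E]); exists e => //= x.
  by rewrite /ball_/= sub0r normrN lee_fin => /ltW; exact/le_trans/ler_norm.
exists N.+1%:R => //; rewrite -lee_fin -prE; last exact: mA.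
exact: hN N (leqnn N).
Qed.

End real_probability.

(** * Tail bounds and a maximal inequality for the Ito integral *)

Section ito_process.
Context (d : measure_display) (T : measurableType d)
    (R : realType) (P : probability T R) (F : R -> set (set T)) (B : R -> T -> R).
Hypotheses (hF : complete_filtration P F) (hB : brownian_motion P F B).
Variable sigma : R -> R.
Hypothesis hsigma : {within `[0, +oo[, continuous sigma}.
Variable I : R -> T -> R.
Hypothesis hI : ito_integral_process P F B sigma I.
Local Notation mu := (@lebesgue_measure R).

Definition var s t : R := \int[mu]_(r in `[s, t]) (sigma r ^+ 2).

Let csig2 s t : 0 <= s -> {within `[s, t], continuous (fun r => sigma r ^+ 2)}.
Proof.
move=> s0; have cst : {within `[s, t], continuous sigma}.
  apply: continuous_subspaceW hsigma => r /=; rewrite !in_itv/= andbT => /andP[sr _].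
  exact: le_trans sr.
move=> r; apply: (@continuous_comp _ _ _ (sigma : subspace _ -> R) (fun y : R => y ^+ 2)).
  exact: cst.
exact: sqr_continuous.
Qed.

Lemma var_ge0 s t : 0 <= var s t.
Proof. by apply: Rintegral_ge0 => r _; exact: sqr_ge0. Qed.

Lemma var_id s : var s s = 0.
Proof. by rewrite /var set_itv1 Rintegral_set1. Qed.

Lemma varD s t u : 0 <= s -> s <= t -> t <= u -> var s u = var s t + var t u.
Proof.
move=> s0 st tu.
have ig : mu.-integrable `[s, u] (EFin \o (fun r => sigma r ^+ 2)).
  by apply: continuous_compact_integrable; [exact: segment_compact|exact: csig2].
have := @Rintegral_itvB _ (fun r => sigma r ^+ 2) (BLeft s) (BRight u) t ig.
rewrite !bnd_simp => /(_ st tu) h; rewrite /var -[X in _ + X]Rintegral_itv_obnd_cbnd; last first.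
  apply: integrableS ig => // r /=; rewrite !in_itv/= => /andP[tr ->].
  by rewrite (le_trans st) ?ltW.
by rewrite -h addrC subrK.
Qed.

Lemma ito_wrt t u : 0 <= t -> t <= u -> measurable_wrt (F u) (I t).
Proof.
move=> t0 tu; apply: (@measurable_wrt_sub _ _ _ (F t)).
  by apply: (filtration_le hF).
by case: hI => _ + _; apply.
Qed.

Lemma ito_measurable t : 0 <= t -> measurable_fun setT (I t).
Proof.
move=> t0; apply: (@measurable_wrt_measurable _ _ _ (F t)).
  exact: filtration_measurable hF _ t0.
exact: ito_wrt.
Qed.

Let approx s t : 0 <= s -> s < t ->
  mgf_approx P (F s) (fun w => I t w - I s w) (var s t).
Proof.
move=> s0 st; have t0 : 0 <= t by lra.
case: (hI) => _ _ hI'.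
apply: (ito_mgf_approx hF hB hsigma s0 st); [exact: ito_measurable|exact: ito_measurable| |];
  exact: hI'.
Qed.

Let measurableB s t : 0 <= s -> 0 <= t -> measurable_fun setT (fun w => I t w - I s w).
Proof. by move=> s0 t0; apply: measurable_funB; exact: ito_measurable. Qed.

Lemma increment_upper_tail s t v x A : 0 <= s -> s <= t -> var s t < v -> 0 < x -> F s A ->
  pr P (A `&` [set w | x < `|I t w - I s w|]) <= pr P A * (2 * expR (- (x ^+ 2 / (8 * v)))).
Proof.
move=> s0; rewrite le_eqVlt => /predU1P[<- vv x0 FA|st vv x0 FA].
  rewrite (_ : _ `&` _ = set0).
    by rewrite /pr measure0/= mulr_ge0 ?pr_ge0// mulr_ge0 ?expR_ge0.
  by rewrite -subset0 => w [_ /=]; rewrite subrr normr0 ltNge (ltW x0).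
have t0 : 0 <= t by lra.
have v0 : 0 < v by apply: le_lt_trans vv; exact: var_ge0.
have Gm := filtration_measurable hF s0.
have mA : measurable A by exact: Gm.
have mD := measurableB s0 t0.
have mx (Y : T -> R) : measurable_fun setT Y -> measurable (A `&` [set w | x < Y w]).
  by move=> mY; apply: measurableI => //; exact: measurable_gt.
have h1 := upper_tail Gm mD (approx s0 st) vv v0 x0 FA.
have mD' : measurable_fun setT (fun w => - (I t w - I s w)) by exact: measurableT_comp.
have h2 := upper_tail Gm mD' (mgf_approxN (approx s0 st)) vv v0 x0 FA.
move: h1 h2; rewrite !prE; [|exact: mx|exact: mA|exact: mx].
rewrite -!EFinM !lee_fin => h1 h2.
rewrite mulrCA mulrDl mul1r; apply: le_trans (lerD h1 h2).
apply: le_trans (prU_le _ (mx _ _) (mx _ _)) => //.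
apply: le_pr.
- by apply: measurableI => //; exact: measurable_abs_gt.
- by apply: measurableU; exact: mx.
- by move=> w [Aw /=]; rewrite ltr_normr => /orP[h|h]; [left|right].
Qed.

Lemma increment_lower_tail s t x A : 0 <= s -> s < t -> 0 < var s t -> 0 < x -> F s A ->
  let c := 4^-1 * expR (- (256 * (x ^+ 2 / var s t + 1))) in
  pr P A * c <= pr P (A `&` [set w | x < I t w - I s w]) /\
  pr P A * c <= pr P (A `&` [set w | x < - (I t w - I s w)]).
Proof.
move=> s0 st v0 x0 FA c.
have t0 : 0 <= t by lra.
have Gm := filtration_measurable hF s0.
have mA : measurable A by exact: Gm.
have mD := measurableB s0 t0.
have mD' : measurable_fun setT (fun w => - (I t w - I s w)) by exact: measurableT_comp.
have mx (Y : T -> R) : measurable_fun setT Y -> measurable (A `&` [set w | x < Y w]).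
  by move=> mY; apply: measurableI => //; exact: measurable_gt.
split; rewrite -lee_fin EFinM -!prE//; try exact: mx.
  exact: lower_tail Gm mD (approx s0 st) v0 x0 FA.
exact: lower_tail Gm mD' (mgf_approxN (approx s0 st)) v0 x0 FA.
Qed.

(** The bound does not depend on the number of times, so it survives monotone limits: over refining
    dyadic grids for the oscillation, over growing horizons for boundedness. *)
Lemma maximal_inequality (tau : nat -> R) (N : nat) v x : 0 <= tau 0%N ->
  {homo tau : i j / (i <= j)%N >-> i <= j} -> var (tau 0%N) (tau N) < v -> 0 < x ->
  pr P [set w | exists2 k, (k <= N)%N & 2 * x < `|I (tau k) w - I (tau 0%N) w|] <=
  4 * expR (- (x ^+ 2 / (8 * v))).
Proof.
move=> tau0 tauh vv x0.
have t0 k : 0 <= tau k by apply: le_trans tau0 (tauh _ _ (leq0n k)).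
pose q := 2 * expR (- (x ^+ 2 / (8 * v))).
pose S k w := I (tau k) w - I (tau 0%N) w.
pose U n := [set w | exists2 k, (k <= n)%N & 2 * x < `|S k w|].
have mS k : measurable_fun setT (S k) by exact: measurableB.
have q0 : 0 < q by rewrite mulr_gt0// expR_gt0.
have sF k := filtration_sigma hF (t0 k).
pose E k := [set w | 2 * x < `|S k w|].
have FE k n : (k <= n)%N -> F (tau n) (E k).
  move=> kn; have h : measurable_wrt (F (tau n)) (S k).
    by apply: measurable_wrtB; [exact: sF|apply: ito_wrt => //; exact: tauh|
      apply: ito_wrt => //; exact: tauh].
  have -> : E k = S k @^-1` [set y | 2 * x < `|y|] by [].
  by apply: measurable_wrt_preimage h; apply: (@measurable_abs_gt _ _ _ id).
have U0 : U 0%N = E 0%N.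
  apply/seteqP; split => w /=; last by exists 0%N.
  by case=> k; rewrite leqn0 => /eqP ->.
have US n : U n.+1 = U n `|` E n.+1.
  apply/seteqP; split => w /=.
    case=> k; rewrite leq_eqVlt => /predU1P[->|]; first by right.
    by rewrite ltnS => kn h; left; exists k.
  by case=> [[k kn h]|h]; [exists k => //; exact: leqW|exists n.+1].
have FU k n : (k <= n)%N -> F (tau n) (U k).
  elim: k => [|k ih] kn; first by rewrite U0; exact: FE.
  rewrite US -(sigma_algebra_id (sF n)).
  apply: (@measurableU _ (g_sigma_algebraType (F (tau n))));
    rewrite /measurable/= sigma_algebra_id//; [exact/ih/ltnW|exact: FE].
have Fm k : F (tau k) `<=` measurable by exact: filtration_measurable hF _ (t0 k).
have mE k : measurable (E k) by apply: (Fm k); exact: FE.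
have mU k : measurable (U k) by apply: (Fm k); exact: FU.
pose C := [set w | x < `|S N w|].
have mC : measurable C by exact: measurable_abs_gt.
(* Ottaviani's argument: after the first exit from [-2x, 2x], either the
   remaining increment exceeds [x] or the final value does. *)
have step n A : (n <= N)%N -> F (tau n) A -> A `<=` E n ->
    pr P (A `&` ~` C) <= q * pr P A.
  move=> nN FA AE; have mA : measurable A by exact: (Fm n).
  have vn : var (tau n) (tau N) < v.
    apply: le_lt_trans vv; rewrite (@varD (tau 0%N) (tau n) (tau N))//; try exact: tauh.
    by rewrite lerDr var_ge0.
  rewrite mulrC; apply: le_trans (increment_upper_tail (t0 n) (tauh _ _ nN) vn x0 FA).
  apply: le_pr.
  - by apply: measurableI => //; exact: measurableC.
  - by apply: measurableI => //; apply: measurable_abs_gt; exact: measurableB.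
  - move=> w [Aw /=] /negP; rewrite -leNgt => SN; split => //=.
    have := AE _ Aw; rewrite /E/= => En.
    have -> : I (tau N) w - I (tau n) w = S N w - S n w by rewrite /S; ring.
    by rewrite distrC; have := lerB_dist (S n w) (S N w); lra.
have claim n : (n <= N)%N -> pr P (U n `&` ~` C) <= q * pr P (U n).
  elim: n => [_|n ih nN]; first by rewrite U0; apply: (step 0%N) => //; exact: FE.
  have FC : F (tau n.+1) (E n.+1 `&` ~` U n).
    rewrite -(sigma_algebra_id (sF n.+1)).
    apply: (@measurableI _ (g_sigma_algebraType (F (tau n.+1)))).
      by rewrite /measurable/= sigma_algebra_id//; exact: FE.
    apply: (@measurableC _ (g_sigma_algebraType (F (tau n.+1)))).
    by rewrite /measurable/= sigma_algebra_id//; apply: FU.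
  have mEU : measurable (E n.+1 `&` ~` U n).
    by apply: measurableI => //; exact: measurableC.
  have UE : U n.+1 = U n `|` (E n.+1 `&` ~` U n).
    by rewrite US setUIr setUCr setIT.
  have disj : U n `&` (E n.+1 `&` ~` U n) = set0.
    by rewrite setIC -setIA setICl setI0.
  rewrite UE setIUl !prU//; last 3 first.
  - by apply: measurableI => //; exact: measurableC.
  - by apply: measurableI => //; exact: measurableC.
  - by rewrite setIACA disj set0I.
  rewrite mulrDr lerD// ?ih ?(ltnW nN)//; apply: (step n.+1) => //.
have pC : pr P C <= q.
  have FT : F (tau 0%N) setT.
    by rewrite -(sigma_algebra_id (sF 0%N)); exact: (@measurableT _ (g_sigma_algebraType _)).
  have := increment_upper_tail (t0 0%N) (tauh _ _ (leq0n N)) vv x0 FT.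
  by rewrite setTI {2}/pr probability_setT mul1r.
have : pr P (U N) <= q * pr P (U N) + q.
  rewrite {1}(prID P (mU N) mC) addrC; apply: lerD; first exact: claim.
  by apply: le_trans pC; apply: le_pr => //; exact: measurableI.
have -> : 4 * expR (- (x ^+ 2 / (8 * v))) = 2 * q by rewrite /q; ring.
change (pr P (U N) <= q * pr P (U N) + q -> pr P (U N) <= 2 * q).
have := pr_ge0 P (U N); have := pr_le1 P (mU N).
(* If [q <= 1 / 2], the term [q * pr P (U N)] is absorbed on the left; otherwise [2 * q] exceeds
   1. *)
have [q2|q2] := leP q 2^-1; nra.
Qed.

End ito_process.

(** * Oscillation and growth of the Ito integral *)

(** By continuity, the oscillation over a whole interval is governed by countably many increments,
    hence by a measurable event. *)
Lemma dyadic_bound (R : realType) (i : R -> R) (n : nat) (c : R) :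
  {within `[0, +oo[, continuous i} ->
  (forall m k, (k <= 2 ^ m)%N -> `|i (n%:R + k%:R / 2 ^+ m) - i n%:R| <= c) ->
  forall t, n%:R <= t -> t <= n.+1%:R -> `|i t - i n%:R| <= c.
Proof.
move=> /subspace_continuousP ci hc t nt tn; apply/ler_addgt0Pr => e e0.
have t0 : 0 <= t by apply: le_trans nt.
have /ci/cvgrPdist_lt/(_ e e0) : `[0, +oo[%classic t by rewrite /= in_itv/= t0.
rewrite near_withinE => /nbhs_ballP[dl /= dl0 hdl].
pose m := Num.bound dl^-1.
have m2 : (2 ^+ m)^-1 < dl.
  rewrite -[ltRHS]invrK ltf_pV2 ?posrE ?exprn_gt0 ?invr_gt0//.
  apply: lt_trans (archi_boundP (ltW _)) _; first by rewrite invr_gt0.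
  by rewrite -natrX ltr_nat ltn_expl.
have p0 : 0 < 2 ^+ m :> R by rewrite exprn_gt0.
pose k := Num.truncn ((t - n%:R) * 2 ^+ m).
have tn0 : 0 <= (t - n%:R) * 2 ^+ m by rewrite mulr_ge0 ?subr_ge0// ltW.
have /andP[k1 k2] := truncn_itv tn0.
have km : (k <= 2 ^ m)%N.
  rewrite -(ler_nat R) natrX; apply: le_trans k1 _.
  by rewrite ler_piMl ?(ltW p0)// lerBlDl natr1.
pose r : R := n%:R + k%:R / 2 ^+ m.
have rt : r <= t by rewrite /r addrC -lerBrDr ler_pdivrMr.
have tr : t - r < (2 ^+ m)^-1.
  have -> : t - r = ((t - n%:R) * 2 ^+ m - k%:R) / 2 ^+ m.
    by rewrite /r; field; rewrite gt_eqF.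
  by rewrite ltr_pdivrMr// mulVf ?gt_eqF// ltrBlDl natr1.
have r0 : 0 <= r by rewrite addr_ge0// divr_ge0// ltW.
have : `|i t - i r| < e.
  apply: hdl; last by rewrite /= in_itv/= r0.
  by rewrite /ball/= ger0_norm ?subr_ge0//; exact: lt_trans m2.
have := hc m k km; rewrite -/r => h1 h2.
have -> : i t - i n%:R = (i t - i r) + (i r - i n%:R) by ring.
by apply: le_trans (ler_normD _ _) _; lra.
Qed.

Section oscillation.
Context (d : measure_display) (T : measurableType d)
    (R : realType) (P : probability T R) (F : R -> set (set T)) (B : R -> T -> R).
Hypotheses (hF : complete_filtration P F) (hB : brownian_motion P F B).
Variable sigma : R -> R.
Hypothesis hsigma : {within `[0, +oo[, continuous sigma}.
Variable I : R -> T -> R.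
Hypothesis hI : ito_integral_process P F B sigma I.
Variable theta : nat -> R.
Hypotheses (htheta0 : forall n, 0 <= theta n)
  (htheta : forall n, theta n ^+ 2 = var sigma n%:R n.+1%:R).

Definition summand (eps : R) (n : nat) : R := if theta n == 0 then 0
  else theta n * expR (- (1 / 2) * (eps ^+ 2 / theta n ^+ 2)).

Let D m n x := [set w | exists2 k, (k <= 2 ^ m)%N &
  2 * x < `|I (n%:R + k%:R / 2 ^+ m) w - I n%:R w|].

Let mD m n x : measurable (D m n x).
Proof.
have -> : D m n x = \bigcup_(k in [set k | (k <= 2 ^ m)%N])
    [set w | 2 * x < `|I (n%:R + k%:R / 2 ^+ m) w - I n%:R w|].
  by apply/seteqP; split => w /= [k kn h]; exists k.
apply: bigcup_measurable => k _; apply: measurable_abs_gt.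
by apply: measurable_funB; apply: (ito_measurable hF hI) => //; rewrite addr_ge0// divr_ge0// exprn_ge0.
Qed.

Definition exceeds x n := \bigcup_m D m n x.

Lemma measurable_exceeds x n : measurable (exceeds x n).
Proof. by apply: bigcup_measurable => m _; exact: mD. Qed.

Lemma pr_exceeds x v n : 0 < x -> theta n ^+ 2 < v ->
  pr P (exceeds x n) <= 4 * expR (- (x ^+ 2 / (8 * v))).
Proof.
move=> x0 vv; apply: pr_bigcup_le => [m|m1 m2 m12|m]; first exact: mD.
  apply/subsetPset => w [k kn h]; exists (k * 2 ^ (m2 - m1))%N.
    by rewrite -[in leqRHS](subnKC m12) expnD leq_mul2r kn orbT.
  rewrite (_ : (k * 2 ^ (m2 - m1))%:R / 2 ^+ m2 = k%:R / 2 ^+ m1 :> R)//.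
  have -> : 2 ^+ m2 = 2 ^+ m1 * 2 ^+ (m2 - m1) :> R by rewrite -exprD subnKC.
  rewrite natrM natrX.
  have a0 : 2 ^+ (m2 - m1) != 0 :> R by rewrite expf_neq0.
  have b0 : 2 ^+ m1 != 0 :> R by rewrite expf_neq0.
  by field; rewrite a0 b0.
pose tau k : R := n%:R + k%:R / 2 ^+ m.
have p0 : 0 < 2 ^+ m :> R by rewrite exprn_gt0.
have tau0 : tau 0%N = n%:R by rewrite /tau mul0r addr0.
have tauN : tau (2 ^ m)%N = n.+1%:R.
  by rewrite /tau natrX divff ?gt_eqF// natr1.
have := @maximal_inequality _ _ _ _ _ _ hF hB _ hsigma _ hI tau (2 ^ m) v x.
rewrite tau0 tauN -htheta; apply => //.
by move=> i j ij; rewrite lerD2l ler_pM2r ?invr_gt0// ler_nat.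
Qed.

(** With [v = 2 * theta n ^+ 2], the level [4 * eps] yields the exponent [eps ^+ 2 / theta n ^+ 2],
    twice the one in the summand. One half is kept; the exponential of the other half is at most
    [theta n / eps] and supplies the factor [theta n]. *)
Lemma pr_exceeds_summand eps n : 0 < eps ->
  pr P (exceeds (4 * eps) n) <= 4 / eps * summand eps n.
Proof.
move=> e0; have x0 : 0 < 4 * eps by rewrite mulr_gt0.
rewrite /summand; have [th0|thn] := eqVneq (theta n) 0.
  rewrite mulr0; apply/ler_addgt0Pr => e he; rewrite add0r.
  (* When [theta n] is 0 every positive [v] is admissible; this one makes the exponent [4 / e], and
     [4 * expR (- (4 / e)) <= e]. *)
  pose v := e * eps ^+ 2 / 2.
  have v0 : 0 < v by rewrite divr_gt0// mulr_gt0// exprn_gt0.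
  have := @pr_exceeds (4 * eps) v n x0; rewrite th0 expr0n => /(_ v0) /le_trans; apply.
  have -> : (4 * eps) ^+ 2 / (8 * v) = 4 / e.
    by rewrite /v; field; rewrite !gt_eqF.
  have e4 : 0 < 4 / e by rewrite divr_gt0.
  rewrite expRN ler_pdivrMr ?expR_gt0//.
  have := expR_ge1Dx (4 / e) => h.
  have : 4 = e * (4 / e) by field; rewrite gt_eqF.
  have : e * (4 / e) <= e * expR (4 / e) by rewrite ler_pM2l//; lra.
  by lra.
have th0 : 0 < theta n by rewrite lt_neqAle eq_sym thn htheta0.
have th2 : 0 < theta n ^+ 2 by rewrite exprn_gt0.
have := @pr_exceeds (4 * eps) (2 * theta n ^+ 2) n x0.
move=> /(_ ltac:(lra)) /le_trans; apply.
pose y := eps ^+ 2 / theta n ^+ 2.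
have -> : (4 * eps) ^+ 2 / (8 * (2 * theta n ^+ 2)) = y / 2 + y / 2.
  by rewrite /y; field; rewrite gt_eqF.
have -> : - (1 / 2) * (eps ^+ 2 / theta n ^+ 2) = - (y / 2) by rewrite /y; field; rewrite gt_eqF.
rewrite opprD expRD mulrA.
have e4 : 4 * expR (- (y / 2)) <= 4 / eps * theta n.
  have h1 := expR_ge1Dx (y / 2); have E0 := expR_gt0 (y / 2).
  have -> : 4 / eps * theta n = 4 * (theta n / eps) by field; rewrite gt_eqF.
  rewrite ler_pM2l// expRN -[leLHS]mul1r ler_pdivrMr// mulrAC ler_pdivlMr// mul1r.
  apply: (@le_trans _ _ (theta n * (1 + y / 2))); last by rewrite ler_pM2l.
  have -> : theta n * (1 + y / 2) = eps + ((theta n - eps) ^+ 2 + theta n ^+ 2) / (2 * theta n).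
    by rewrite /y; field; rewrite gt_eqF.
  by rewrite lerDl divr_ge0 ?mulr_ge0 ?addr_ge0 ?sqr_ge0.
by rewrite mulrA ler_wpM2r// expR_ge0.
Qed.

Lemma ae_oscillation :
  (forall eps, 0 < eps -> (\sum_(1 <= n <oo) (summand eps n)%:E < +oo)%E) ->
  {ae P, forall w, forall e, 0 < e -> exists N : nat, forall n : nat, (N <= n)%N ->
    forall t, n%:R <= t -> t <= n.+1%:R -> `|I t w - I n%:R w| <= e}.
Proof.
move=> hA.
pose eps (j : nat) : R := j.+1%:R^-1.
have eps0 j : 0 < eps j by rewrite invr_gt0.
(* The sum in (A) starts at 1, so index 0 is emptied; a limit superior of events does not see it. *)
pose G j n := if n == 0%N then set0 else exceeds (4 * eps j) n.
have mG j n : measurable (G j n).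
  by rewrite /G; case: ifP => _ //; exact: measurable_exceeds.
have G0 j : P (lim_sup_set (G j)) = 0%E.
  apply: lim_sup_set_cvg0 => //.
  rewrite nneseries_recl//= {1}/G eqxx measure0 add0e.
  apply: (@le_lt_trans _ _ (\sum_(1 <= n <oo) ((4 / eps j)%:E * (summand (eps j) n)%:E))%E).
    apply: lee_nneseries => // n _; rewrite -EFinM prE// lee_fin /G.
    case: eqP => [_|_]; last exact: pr_exceeds_summand.
    rewrite /pr measure0/= mulr_ge0//; first by rewrite divr_ge0// ltW.
    by rewrite /summand; case: ifP => // _; rewrite mulr_ge0// expR_ge0.
  rewrite nneseriesZl//; last first.
    move=> n _; rewrite lee_fin /summand; case: ifP => // _.
    by rewrite mulr_ge0// expR_ge0.
  by rewrite lte_mul_pinfty ?hA// lee_fin divr_ge0// ltW.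
have aeG : {ae P, forall w, forall j, ~ lim_sup_set (G j) w}.
  apply: ae_foralln => j; exists (lim_sup_set (G j)); split => //.
  - by apply: bigcapT_measurable => n; exact: bigcup_measurable.
  - exact: G0.
  - by move=> w /= /contrapT.
case: (hI) => cI _ _.
apply: filterS2 aeG cI => w hw ciw e e0.
(* Outside [exceeds (4 * eps j) n] the increments are at most [2 * (4 * eps j)], hence the [8]. *)
pose j := Num.bound (8 / e).
have ej : 8 * eps j <= e.
  rewrite /eps ler_pdivrMr// mulrC -ler_pdivrMr//.
  apply: le_trans (ltW (archi_boundP (ltW _))) _; first by rewrite divr_gt0.
  by rewrite ler_nat.
have [N hN] : exists N, forall n, (N <= n)%N -> ~ G j n w.
  have := hw j; rewrite /lim_sup_set => /existsNP[N /not_implyP[_ hN]].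
  by exists N => n Nn Gn; apply: hN; exists n.
exists (maxn N 1) => n; rewrite geq_max => /andP[Nn n1] t nt tn.
apply: le_trans ej; apply: (@dyadic_bound _ (fun t => I t w)) => // m k km.
rewrite leNgt; apply/negP => h; apply: (hN n Nn); rewrite /G gtn_eqF//.
by exists m => //; exists k => //; rewrite (_ : 2 * (4 * eps j) = 8 * eps j)//; ring.
Qed.

Lemma var_sum n : var sigma 0 n%:R = \sum_(k < n) theta k ^+ 2.
Proof.
elim: n => [|n ih]; first by rewrite big_ord0 var_id.
by rewrite big_ord_recr/= -ih htheta -(varD hsigma)// ler_nat.
Qed.

(** A bounded total variance makes the maximal inequality along the integers uniform in the horizon,
    so the supremum has Gaussian tails. *)
Lemma ae_bounded (V : R) : (forall n, \sum_(k < n) theta k ^+ 2 <= V) ->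
  {ae P, forall w, exists K, forall n : nat, `|I n%:R w - I 0 w| <= K}.
Proof.
move=> hV.
have V0 : 0 <= V by have := hV 0%N; rewrite big_ord0.
pose E K N := [set w | exists2 k, (k <= N)%N &
  2 * K.+1%:R < `|I k%:R w - I 0%:R w|].
pose U K := \bigcup_N E K N.
have mE K N : measurable (E K N).
  have -> : E K N = \bigcup_(k in [set k | (k <= N)%N])
      [set w | 2 * K.+1%:R < `|I k%:R w - I 0%:R w|].
    by apply/seteqP; split => w /= [k kn h]; exists k.
  apply: bigcup_measurable => k _; apply: measurable_abs_gt.
  by apply: measurable_funB; exact: (ito_measurable hF hI).
have mU K : measurable (U K) by exact: bigcup_measurable.
have pU K : pr P (U K) <= 4 * expR (- (K.+1%:R ^+ 2 / (8 * (V + 1)))).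
  apply: pr_bigcup_le => // [N1 N2 N12|N].
    by apply/subsetPset => w [k kN h]; exists k => //; exact: leq_trans N12.
  apply: (@maximal_inequality _ _ _ _ _ _ hF hB _ hsigma _ hI (fun k => k%:R)) => //.
    by move=> i j; rewrite ler_nat.
  by rewrite var_sum; have := hV N; lra.
have : P.-negligible (\bigcap_K U K).
  apply: pr0_negligible; first exact: bigcap_measurable.
  apply/ler_addgt0Pr => e e0; rewrite add0r; apply: pr_bigcap_le => //.
  (* For the exponent [z = K.+1%:R ^+ 2 / (8 * (V + 1))], [4 * expR (- z) <= e] follows from
     [4 <= e * z], that is, [32 * (V + 1) <= e * K.+1%:R ^+ 2]. *)
  pose K := Num.bound (32 * (V + 1) / e); exists K.
  apply: le_trans (pU K) _.
  have K1 : 1 <= K.+1%:R :> R by rewrite ler1n.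
  have hK : 32 * (V + 1) <= e * K.+1%:R.
    rewrite [leRHS]mulrC -ler_pdivrMr//.
    have h : 0 <= 32 * (V + 1) / e by rewrite divr_ge0 ?(ltW e0)//; lra.
    by apply: le_trans (ltW (archi_boundP h)) _; rewrite ler_nat.
  set z := _ / _; have h := expR_ge1Dx z; have E0 := expR_gt0 z.
  have z0 : 32 * (V + 1) * z = 4 * K.+1%:R ^+ 2.
    by rewrite /z; field; lra.
  rewrite expRN ler_pdivrMr//.
  have : e * z <= e * expR z by rewrite ler_pM2l//; lra.
  suff : 4 <= e * z by lra.
  have V1 : 0 < 32 * (V + 1) by lra.
  rewrite -(ler_pM2l V1) mulrCA z0; nra.
move=> h; apply: (negligibleS _ h) => w /= /forallNP hw K _.
have /existsNP[n] := hw (2 * K.+1%:R).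
by move=> /negP; rewrite -ltNge => hn; exists n => //; exists n.
Qed.

(** A fixed fraction [c] of any event of the past sees an arbitrarily large later fall. The infimum
    [q] of the probabilities of having stayed above a level therefore satisfies [q <= (1 - c) * q],
    and vanishes. [Y] is abstract so as to cover both [I] and its opposite. *)
Lemma ae_unbounded (Y : nat -> T -> R) (c : R) : 0 < c ->
  (forall n k, (k <= n)%N -> measurable_wrt (F n%:R) (Y k)) ->
  (forall n K, 0 < K -> exists N, (n <= N)%N /\ forall A, F n%:R A ->
     c * pr P A <= pr P (A `&` [set w | K < - (Y N w - Y n w)])) ->
  {ae P, forall w, forall K, exists n, Y n w < K}.
Proof.
move=> c0 mY hY.
have sF n : sigma_algebra setT (F n%:R) by exact: filtration_sigma hF _ _.
have Fm n : F n%:R `<=` measurable by exact: filtration_measurable hF _ _.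
have mY' n : measurable_fun setT (Y n).
  exact: measurable_wrt_measurable (Fm n) (mY n n (leqnn n)).
have c1 : c <= 1.
  have [N [_ h]] := hY 0%N 1 ltr01.
  have FT : F 0%:R setT.
    by rewrite -(sigma_algebra_id (sF 0%N)); exact: (@measurableT _ (g_sigma_algebraType _)).
  have := h _ FT; rewrite {1}/pr probability_setT mulr1 => /le_trans; apply.
  apply: pr_le1; apply: measurableI => //; apply: measurable_gt.
  by apply: measurableT_comp => //; exact: measurable_funB.
suff h K : {ae P, forall w, exists n, Y n w < - K%:R}.
  have := ae_foralln h; apply: filterS => w hw K.
  have [n hn] := hw (Num.bound `|K|); exists n; apply: lt_le_trans hn _.
  rewrite lerNl; apply: le_trans (ltW (archi_boundP (normr_ge0 K))).
  by rewrite -normrN ler_norm.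
pose A n := [set w | forall k, (k <= n)%N -> - K%:R <= Y k w].
have FA n : F n%:R (A n).
  rewrite -(sigma_algebra_id (sF n)).
  have -> : A n = \bigcap_(k in [set k | (k <= n)%N]) [set w | - K%:R <= Y k w].
    by apply/seteqP; split => w.
  apply: (@bigcap_measurable _ (g_sigma_algebraType (F n%:R))); first by exists 0%N.
  move=> k kn; rewrite /measurable/= sigma_algebra_id//.
  have -> : [set w | - K%:R <= Y k w] = Y k @^-1` `[- K%:R, +oo[.
    by apply/seteqP; split => w /=; rewrite in_itv/= andbT.
  exact: measurable_wrt_preimage (mY n k kn).
have mA n : measurable (A n) by exact: (Fm n).
pose p n := pr P (A n).
(* Outside an event of probability at most [e], [Y n] is at most [M], so a fall by more than
   [K%:R + M] ends below [- K%:R]. *)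
have step n e : 0 < e -> exists N, p N <= (1 - c) * p n + e.
  move=> e0; have [M M0 hM] := pr_tail P (mY' n) e0.
  have K0 : 0 < K%:R + M by rewrite ltr_wpDl.
  have [N [nN hN]] := hY n (K%:R + M) K0; exists N.
  pose C := [set w | M < `|Y n w|].
  have mC : measurable C by exact: measurable_abs_gt.
  have FC : F n%:R (A n `&` ~` C).
    rewrite -(sigma_algebra_id (sF n)).
    apply: (@measurableI _ (g_sigma_algebraType (F n%:R))).
      by rewrite /measurable/= sigma_algebra_id.
    apply: (@measurableC _ (g_sigma_algebraType (F n%:R))).
    rewrite /measurable/= sigma_algebra_id//.
    have -> : C = Y n @^-1` [set y | M < `|y|] by [].
    by apply: measurable_wrt_preimage (mY n n (leqnn n)); apply: (@measurable_abs_gt _ _ _ id).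
  pose J := [set w | K%:R + M < - (Y N w - Y n w)].
  have mJ : measurable J.
    apply: measurable_gt.
    by apply: measurableT_comp => //; exact: measurable_funB.
  have mAC : measurable (A n `&` ~` C) by exact: (Fm n).
  rewrite {1}/p (prID P (mA N) mC) addrC; apply: lerD; last first.
    by apply: le_trans hM; apply: le_pr => //; exact: measurableI.
  apply: (@le_trans _ _ (pr P (A n `&` ~` C `&` ~` J))).
    apply: le_pr.
    - by apply: measurableI => //; exact: measurableC.
    - by apply: measurableI => //; exact: measurableC.
    - move=> w [AN /= nC]; split; [split=> //|].
        by move=> k kn; apply: AN; exact: leq_trans nN.
      rewrite /J/= => hJ; have := AN N (leqnn N).
      move: nC; rewrite /C/= => /negP; rewrite -leNgt ler_norml => /andP[_ ?]; lra.
  have := prID P mAC mJ; have := hN _ FC; rewrite -/J => h1 h2.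
  have h3 : pr P (A n `&` ~` C) <= p n by apply: le_pr => //; exact: subIsetl.
  have : pr P (A n `&` ~` C `&` ~` J) <= (1 - c) * pr P (A n `&` ~` C) by lra.
  move=> /le_trans; apply; rewrite ler_wpM2l//; lra.
pose q := inf (range p).
have qle n : q <= p n.
  by apply: ge_inf; [exists 0 => _ [m _ <-]; exact: pr_ge0|exists n].
have q0 : 0 <= q.
  by apply: lb_le_inf; [exists (p 0%N); exists 0%N|move=> _ [m _ <-]; exact: pr_ge0].
have qle' n : q <= (1 - c) * p n.
  apply/ler_addgt0Pr => e e0; have [N hN] := step n e e0.
  exact: le_trans (qle N) hN.
have q00 : q <= 0.
  have [c1'|c1'] := eqVneq c 1; first by have := qle' 0%N; rewrite c1' subrr mul0r.
  have c10 : 0 < 1 - c by rewrite subr_gt0 lt_neqAle c1'.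
  have : q / (1 - c) <= q.
    apply: lb_le_inf; first by exists (p 0%N); exists 0%N.
    by move=> _ [m _ <-]; rewrite ler_pdivrMr// mulrC.
  by rewrite ler_pdivrMr//; nra.
have : P.-negligible (\bigcap_n A n).
  apply: pr0_negligible; first exact: bigcap_measurable.
  apply: le_trans q00; apply: lb_le_inf; first by exists (p 0%N); exists 0%N.
  by move=> _ [m _ <-]; apply: pr_bigcap_le => //; exists m.
move=> h; apply: (negligibleS _ h) => w /= /forallNP hw n _ k kn.
by rewrite leNgt; apply/negP; exact: hw.
Qed.

Lemma ae_ito_unbounded : (forall V, exists n, V < \sum_(k < n) theta k ^+ 2) ->
  {ae P, forall w, forall K, (exists n : nat, I n%:R w < K) /\ (exists n : nat, K < I n%:R w)}.
Proof.
move=> hV.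
(* [N] will be taken with variance above [K ^+ 2] over [[n, N]]; then
   [256 * (K ^+ 2 / var + 1) <= 512] whatever [n] and [K] are. *)
pose c : R := 4^-1 * expR (- 512).
have c0 : 0 < c by apply: mulr_gt0; [rewrite invr_gt0 ltr0n|exact: expR_gt0].
have hI' n K : 0 < K -> exists N, (n <= N)%N /\ forall A, F n%:R A ->
     c * pr P A <= pr P (A `&` [set w | K < I N%:R w - I n%:R w]) /\
     c * pr P A <= pr P (A `&` [set w | K < - (I N%:R w - I n%:R w)]).
  move=> K0; have [N hN] := hV (K ^+ 2 + var sigma 0 n%:R); rewrite -var_sum in hN.
  have nN : (n < N)%N.
    rewrite ltnNge; apply/negP => Nn; move: hN.
    rewrite (@varD _ _ hsigma 0 N%:R n%:R) ?ler_nat//.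
    by have := var_ge0 sigma N%:R n%:R; have := sqr_ge0 K; lra.
  have vE : K ^+ 2 < var sigma n%:R N%:R.
    by move: hN; rewrite (@varD _ _ hsigma 0 n%:R N%:R) ?ler_nat 1?ltnW//; lra.
  have v0 : 0 < var sigma n%:R N%:R by apply: le_lt_trans vE; exact: sqr_ge0.
  exists N; split; first exact: ltnW.
  move=> A FA.
  have nN' : n%:R < N%:R :> R by rewrite ltr_nat.
  have [h1 h2] := increment_lower_tail hF hB hsigma hI (ler0n _ n) nN' v0 K0 FA.
  have hc : c * pr P A <=
      pr P A * (4^-1 * expR (- (256 * (K ^+ 2 / var sigma n%:R N%:R + 1)))).
    rewrite mulrC ler_wpM2l ?pr_ge0// ler_pM2l// ler_expR lerN2.
    have : K ^+ 2 / var sigma n%:R N%:R <= 1 by rewrite ler_pdivrMr// mul1r ltW.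
    by lra.
  by split; [apply: le_trans h1|apply: le_trans h2].
have h1 : {ae P, forall w, forall K, exists n : nat, I n%:R w < K}.
  apply: (ae_unbounded c0).
    by move=> n k kn; apply: (ito_wrt hF hI) => //; rewrite ler_nat.
  move=> n K K0; have [N [nN h]] := hI' n K K0; exists N; split => // A FA.
  by have [] := h A FA.
have h2 : {ae P, forall w, forall K, exists n : nat, - I n%:R w < K}.
  apply: (@ae_unbounded (fun n w => - I n%:R w) c c0).
    move=> n k kn; have -> : (fun w => - I k%:R w) = (fun w => 0 - I k%:R w).
      by apply/funext => w; rewrite sub0r.
    apply: measurable_wrtB; [exact: filtration_sigma hF _ _| |].
      by apply: measurable_wrt_cst; exact: filtration_sigma hF _ _.
    by apply: (ito_wrt hF hI) => //; rewrite ler_nat.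
  move=> n K K0; have [N [nN h]] := hI' n K K0; exists N; split => // A FA.
  have [+ _] := h A FA; congr (_ <= pr P (_ `&` _)).
  by apply/seteqP; split => w /=; rewrite opprB opprK addrC.
apply: filterS2 h1 h2 => w h1 h2 K; split; first exact: h1.
by have [n hn] := h2 (- K); exists n; rewrite -ltrN2.
Qed.

End oscillation.

(** * Pathwise analysis *)

Section crossing.
Context {R : realType}.
Implicit Types (x : R -> R) (a b r : R).

Let IVT_lr x a b c : a <= b -> {within `[a, b], continuous x} ->
  (x a <= c <= x b) || (x b <= c <= x a) -> exists2 r, a <= r <= b & x r = c.
Proof.
move=> ab cx h; have [|r rab xr] := @IVT _ x a b c ab cx.
  by rewrite ge_min le_max; case/orP : h => /andP[-> ->]; rewrite ?orbT.
by exists r.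
Qed.

Let limit_point x a b t c : a <= t <= b -> {within `[a, b], continuous x} ->
  (forall e, 0 < e -> exists r, [/\ a <= r <= b, `|r - t| < e & x r = c]) -> x t = c.
Proof.
move=> tab /subspace_continuousP cx h; apply/eqP/negPn/negP => xtc.
have e0 : 0 < `|x t - c| by rewrite normr_gt0 subr_eq0.
have : `[a, b]%classic t by rewrite /= in_itv.
move=> /cx/cvgrPdist_lt/(_ _ e0); rewrite near_withinE => /nbhs_ballP[dl /= dl0 hdl].
have [r [rab rt xr]] := h _ dl0.
have : `|x t - x r| < `|x t - c|.
  by apply: hdl; [rewrite /ball/= distrC|rewrite /= in_itv].
by rewrite xr ltxx.
Qed.

(** [t] is the first time at level [be], and [s] the last time before it at level [al]; by the
    intermediate value theorem the path stays in the band in between. *)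
Lemma crossing x a b al be : a <= b -> {within `[a, b], continuous x} ->
  x a <= al -> al < be -> be <= x b ->
  exists s t, [/\ a <= s <= t, t <= b, x s = al, x t = be &
    forall r, s < r -> r <= t -> al <= x r <= be].
Proof.
move=> ab cx xa albe xb.
have sub a' b' : a <= a' -> b' <= b -> {within `[a', b'], continuous x}.
  move=> aa bb; apply: continuous_subspaceW cx => r /=; rewrite !in_itv/=.
  by move=> /andP[h1 h2]; apply/andP; split; [exact: le_trans h1|exact: le_trans h2 _].
pose K := [set r | a <= r <= b /\ x r = be].
have K0 : K !=set0.
  have [|r rab xr] := @IVT_lr x a b be ab cx; last by exists r.
  by apply/orP; left; apply/andP; split=> //; lra.
have lbK : has_lbound K by exists a => r [/andP[]].
have aK : a <= inf K by apply: lb_le_inf => // r [/andP[]].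
have Kb : inf K <= b.
  by case: (K0) => r Kr; apply: le_trans (ge_inf lbK Kr) _; case: Kr => /andP[].
have xt : x (inf K) = be.
  apply: (limit_point (a := a) (b := b)) => //; first by rewrite aK.
  move=> e e0; have [r Kr hr] := inf_adherent e0 (conj K0 lbK).
  exists r; case: (Kr) => rab xr; split => //.
  by rewrite ger0_norm ?subr_ge0 ?ge_inf//; lra.
set t := inf K in aK Kb xt *.
have lt_t r : a <= r -> r <= t -> x r <= be.
  move=> ar rt; rewrite leNgt; apply/negP => xr.
  have [||c /andP[ac cr] xc] := @IVT_lr x a r be ar; first exact: sub (le_trans rt Kb).
    by apply/orP; left; apply/andP; split; lra.
  have Kc : K c by split=> //; rewrite ac (le_trans cr)// (le_trans rt).
  have tc : t <= c by exact: ge_inf.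
  have rE : r = t by apply/eqP; rewrite eq_le rt (le_trans tc).
  by move: xr; rewrite rE xt ltxx.
pose L := [set r | a <= r <= t /\ x r = al].
have L0 : L !=set0.
  have [||r rab xr] := @IVT_lr x a t al aK; last by exists r.
    exact: sub.
  by apply/orP; left; apply/andP; split=> //; lra.
have ubL : has_ubound L by exists t => r [/andP[]].
have aL : a <= sup L.
  by case: (L0) => r Lr; apply: le_trans (ub_le_sup ubL Lr); case: Lr => /andP[].
have Lt : sup L <= t by apply: ge_sup => // r [/andP[]].
have xs : x (sup L) = al.
  apply: (limit_point (a := a) (b := t)) => //; [by rewrite aL|exact: sub|].
  move=> e e0; have [r Lr hr] := sup_adherent e0 (conj L0 ubL).
  exists r; case: (Lr) => rab xr; split => //.
  by rewrite distrC ger0_norm ?subr_ge0 ?ub_le_sup//; lra.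
exists (sup L), t; split => //; first by rewrite aL.
move=> r sr rt.
have ar : a <= r by apply: le_trans aL (ltW sr).
rewrite lt_t// andbT leNgt; apply/negP => xr.
have [||c /andP[rc ct] xc] := @IVT_lr x r t al rt; first exact: sub.
  by apply/orP; left; apply/andP; split; lra.
have : c <= sup L by apply: ub_le_sup => //; split=> //; rewrite ct (le_trans ar).
by rewrite leNgt (lt_le_trans sr).
Qed.

End crossing.

(** * The integral equation driven by a fixed path *)

Section pathwise.
Context {R : realType}.
Local Notation mu := (@lebesgue_measure R).

Definition small_oscillation (i : R -> R) := forall e, 0 < e -> exists N : nat,
  forall n : nat, (N <= n)%N -> forall t, n%:R <= t -> t <= n.+1%:R -> `|i t - i n%:R| <= e.

Definition bounded_or_oscillating (i : R -> R) :=
  (exists K, forall n : nat, `|i n%:R| <= K) \/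
  (forall K, (exists n : nat, i n%:R < K) /\ (exists n : nat, K < i n%:R)).

Definition solves (f x i : R -> R) (xi : R) := {within `[0, +oo[, continuous x} /\
  forall t, 0 <= t -> x t = xi - \int[mu]_(r in `[0, t]) f (x r) + i t.

Lemma solves_increment (f x i : R -> R) (xi m M s t : R) : continuous f -> solves f x i xi ->
  0 <= s -> s <= t ->
  ((forall r, s < r -> r <= t -> m <= f (x r)) ->
    m * (t - s) <= (x s - x t) + (i t - i s)) /\
  ((forall r, s < r -> r <= t -> f (x r) <= M) ->
    (x s - x t) + (i t - i s) <= M * (t - s)).
Proof.
move=> cf [cx xE] s0 st.
have cfx : {within `[0, t], continuous (fun r => f (x r))}.
  move=> r; apply: (@continuous_comp _ _ _ (x : subspace _ -> R) f); last exact: cf.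
  apply: continuous_subspaceW cx _ => y /=.
  by rewrite !in_itv/= => /andP[->].
have := @Rintegral_increment_bounds _ (fun r => f (x r)) 0 s t m M s0 st cfx.
rewrite (xE s s0) (xE t (le_trans s0 st)).
by move=> [h1 h2]; split => [/h1|/h2]; lra.
Qed.

Lemma solvesN (f x i : R -> R) xi : continuous f -> solves f x i xi ->
  solves (fun y => - f (- y)) (fun t => - x t) (fun t => - i t) (- xi).
Proof.
move=> cf [cx xE]; split.
  by move=> r; apply: continuousN; exact: cx.
move=> t t0; rewrite xE//.
have cfx : {within `[0, t], continuous (fun r => f (x r))}.
  move=> r; apply: (@continuous_comp _ _ _ (x : subspace _ -> R) f); last exact: cf.
  apply: continuous_subspaceW cx _ => y /=.
  by rewrite !in_itv/= => /andP[->].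
under [in RHS]eq_Rintegral do rewrite opprK -mulN1r.
rewrite RintegralZl//; last first.
  by apply: continuous_compact_integrable => //; exact: segment_compact.
by ring.
Qed.

Lemma small_oscillationN i : small_oscillation i -> small_oscillation (fun t => - i t).
Proof.
move=> h e /h[N hN]; exists N => n /hN {}hN t nt tn.
by rewrite -opprD normrN; exact: hN.
Qed.

Lemma bounded_or_oscillatingN i : bounded_or_oscillating i ->
  bounded_or_oscillating (fun t => - i t).
Proof.
move=> [[K hK]|h]; first by left; exists K => n; rewrite normrN.
right => K; have [[n hn] [m hm]] := h (- K).
by split; [exists m|exists n]; lra.
Qed.

(** Moving from [s] and [t] to their integer parts costs [e] each, and at most [t - s + 1] unit
    steps separate these integers, hence the [3]. Growth of slope [e] is what the drift has to
    beat. *)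
Lemma chained_oscillation (i : R -> R) (e : R) (N : nat) :
  (forall n : nat, (N <= n)%N ->
    forall t, n%:R <= t -> t <= n.+1%:R -> `|i t - i n%:R| <= e) ->
  forall s t, N%:R <= s -> s <= t -> `|i t - i s| <= e * (t - s + 3).
Proof.
move=> h s t Ns st.
have e0 : 0 <= e by apply: le_trans (h N (leqnn N) N%:R _ _); rewrite ?ler_nat.
have s0 : 0 <= s by apply: le_trans Ns.
have t0 : 0 <= t by apply: le_trans st.
pose n := Num.truncn s; pose m := Num.truncn t.
have /andP[n1 n2] := truncn_itv s0; have /andP[m1 m2] := truncn_itv t0.
rewrite -/n in n1 n2; rewrite -/m in m1 m2.
have Nn : (N <= n)%N by rewrite truncn_ge_nat.
have nm : (n <= m)%N by rewrite truncn_ge_nat// (le_trans n1).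
have key k : `|i (n + k)%:R - i n%:R| <= e * k%:R.
  elim: k => [|k ih]; first by rewrite addn0 subrr normr0 mulr0.
  have := h (n + k)%N (leq_trans Nn (leq_addr _ _)) (n + k.+1)%:R.
  rewrite addnS => /(_ _ _) h'.
  have {}h' : `|i (n + k).+1%:R - i (n + k)%:R| <= e by apply: h'; rewrite ler_nat.
  have -> : i (n + k).+1%:R - i n%:R =
      (i (n + k).+1%:R - i (n + k)%:R) + (i (n + k)%:R - i n%:R) by ring.
  apply: le_trans (ler_normD _ _) _.
  by rewrite -(natr1 k) mulrDr mulr1; lra.
have h1 := h m (leq_trans Nn nm) t m1 (ltW m2).
have h2 := h n Nn s n1 (ltW n2).
have h3 := key (m - n)%N; rewrite subnKC// natrB// in h3.
have -> : i t - i s = (i t - i m%:R) + (i m%:R - i n%:R) - (i s - i n%:R) by ring.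
apply: le_trans (ler_normB _ _) _.
apply: (@le_trans _ _ (e + e * (m%:R - n%:R) + e)).
  by apply: lerD => //; apply: le_trans (ler_normD _ _) _; exact: lerD.
have : e * (m%:R - n%:R) <= e * (t - s + 1).
  apply: ler_wpM2l => //; move: n2; rewrite -natr1; lra.
by rewrite !mulrDr; lra.
Qed.

(** The induction lowers the level: a value below [i N%:R] at an index at least [N] cannot sit at
    [N] itself. *)
Lemma frequently_small (i : R -> R) : (forall K, exists n : nat, i n%:R < K) ->
  forall (K : R) (N : nat), exists n, (N <= n)%N /\ i n%:R < K.
Proof.
move=> h K N; elim: N K => [|N ih] K; first by have [n hn] := h K; exists n.
have [n [Nn]] := ih (Num.min K (i N%:R)); rewrite lt_min => /andP[h1 h2].
exists n; split=> //; rewrite ltn_neqAle Nn andbT.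
by apply/negP => /eqP nE; rewrite nE ltxx in h2.
Qed.

Lemma positive_min (f : R -> R) (a b : R) : continuous f ->
  (forall y, y != 0 -> 0 < y * f y) -> 0 < a -> a <= b ->
  exists2 m, 0 < m & forall y, a <= y -> y <= b -> m <= f y.
Proof.
move=> cf fs a0 ab.
have [c cab hc] := @EVT_min _ f a b ab (continuous_subspaceT cf).
have c0 : 0 < c by move: cab; rewrite in_itv/= => /andP[? _]; lra.
exists (f c); first by rewrite -(pmulr_rgt0 _ c0) fs// gt_eqF.
by move=> y ay yb; apply: hc; rewrite in_itv/= ay.
Qed.

Lemma not_eventually_ge (f x i : R -> R) (xi eta T : R) : continuous f ->
  (forall y, y != 0 -> 0 < y * f y) -> solves f x i xi -> small_oscillation i ->
  bounded_or_oscillating i -> 0 < eta ->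
  exists2 t, T <= t & x t < eta.
Proof.
move=> cf fs sol osc dich eta0; apply: contrapT => hx.
have {}hx t : T <= t -> eta <= x t.
  by move=> Tt; rewrite leNgt; apply/negP => xt; apply: hx; exists t.
have [N hN] := osc 1 ltr01.
pose s := Num.max T N%:R.
have Ts : T <= s by rewrite le_max lexx.
have Ns : N%:R <= s by rewrite le_max lexx orbT.
have s0 : 0 <= s by apply: le_trans Ns.
have f0 y : eta <= y -> 0 <= f y.
  move=> ey; have y0 : 0 < y by lra.
  by rewrite -(pmulr_rge0 _ y0) ltW// fs// gt_eqF.
have decr t : s <= t -> x t <= x s + (i t - i s).
  move=> st; have [h _] := solves_increment 0 0 cf sol s0 st.
  have : 0 * (t - s) <= (x s - x t) + (i t - i s).
    by apply: h => r sr _; apply/f0/hx/(le_trans Ts)/ltW.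
  by rewrite mul0r; lra.
case: dich => [[K hK]|hK].
- have iK t : s <= t -> `|i t| <= K + 1.
    move=> st; have t0 : 0 <= t by lra.
    have /andP[n1 n2] := truncn_itv t0.
    have Nn : (N <= Num.truncn t)%N by rewrite truncn_ge_nat// (le_trans Ns).
    have := hN _ Nn t n1 (ltW n2); have := hK (Num.truncn t).
    set j := i _ => h1 h2; have -> : i t = j + (i t - j) by ring.
    by apply: le_trans (ler_normD _ _) _; lra.
  pose M := x s + 2 * (K + 1).
  have K0 : 0 <= K by apply: le_trans (hK 0%N).
  have bnd t : s <= t -> i t - i s <= 2 * (K + 1).
    move=> st; have := iK t st; have := iK s (lexx _).
    by rewrite !ler_norml => /andP[? ?] /andP[? ?]; lra.
  have xM t : s <= t -> x t <= M by move=> st; have := decr t st; have := bnd t st; rewrite /M; lra.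
  have eM : eta <= M by apply: le_trans (xM s (lexx _)); exact: hx.
  have [m m0 hm] := positive_min cf fs eta0 eM.
  (* By this time the drift amounts to at least [M + m], whereas the starting value and the driving
     path together provide at most [M]. *)
  pose t := s + (M / m + 1).
  have Mm : 0 < M / m by rewrite divr_gt0//; lra.
  have st : s <= t by rewrite /t; lra.
  have [h _] := solves_increment m 0 cf sol s0 st.
  have : m * (t - s) <= (x s - x t) + (i t - i s).
    apply: h => r sr _; apply: hm; first exact/hx/(le_trans Ts)/ltW.
    exact/xM/ltW.
  have -> : m * (t - s) = M + m by rewrite /t; field; rewrite gt_eqF.
  have := bnd t st; have := hx t (le_trans Ts st); rewrite /M; lra.
(* Once [i] is below [i s - x s], the bound [decr] makes [x] negative, against [eta <= x]. *)
- have [n [n1 n2]] := frequently_small (fun K => (hK K).1) (i s - x s) (Num.bound s).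
  have sn : s <= n%:R by apply: le_trans (ltW (archi_boundP s0)) _; rewrite ler_nat.
  by have := decr _ sn; have := hx _ (le_trans Ts sn); lra.
Qed.

Lemma eventually_le (f x i : R -> R) (xi eps : R) : continuous f ->
  (forall y, y != 0 -> 0 < y * f y) -> solves f x i xi -> small_oscillation i ->
  bounded_or_oscillating i -> 0 < eps ->
  exists T, forall t, T <= t -> x t <= eps.
Proof.
move=> cf fs sol osc dich e0.
have e2 : 0 < eps / 2 by rewrite divr_gt0.
have [m m0 hm] := positive_min cf fs e2 (ltW (ltac:(lra) : eps / 2 < eps)).
(* During a climb from [eps / 2] to [eps] the driving path contributes at most [dl * (u - s + 3)].
   The drift cancels the linear part since [dl <= m], and the remaining [3 * dl <= eps / 4] falls
   short of the climb. *)
pose dl := Num.min m (eps / 12).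
have dl0 : 0 < dl by rewrite lt_min m0 divr_gt0.
have [dlm dle] : dl <= m /\ dl <= eps / 12 by split; rewrite /dl ge_min lexx ?orbT.
have [N hN] := osc dl dl0.
have [T0 NT xT] := not_eventually_ge N%:R cf fs sol osc dich e2.
have T00 : 0 <= T0 by apply: le_trans NT.
exists T0 => t Tt; rewrite leNgt; apply/negP => xt.
have cxT : {within `[T0, t], continuous x}.
  apply: continuous_subspaceW (sol.1) => r /=; rewrite !in_itv/= andbT => /andP[h _].
  exact: le_trans h.
have [s [u [/andP[Ts su] ut xs xu hb]]] := crossing Tt cxT (ltW xT)
  (ltac:(lra) : eps / 2 < eps) (ltW xt).
have [h _] := solves_increment m 0 cf sol (le_trans T00 Ts) su.
have : m * (u - s) <= (x s - x u) + (i u - i s).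
  by apply: h => r sr ru; have /andP[? ?] := hb r sr ru; exact: hm.
have := chained_oscillation hN (le_trans NT Ts) su; rewrite ler_norml => /andP[_ h2].
have h3 : dl * (u - s) <= m * (u - s) by rewrite ler_wpM2r ?subr_ge0.
by move: h2; rewrite xs xu mulrDr; lra.
Qed.

Lemma solves_cvg0 (f x i : R -> R) (xi : R) : continuous f ->
  (forall y, y != 0 -> 0 < y * f y) -> solves f x i xi -> small_oscillation i ->
  bounded_or_oscillating i -> x t @[t --> +oo] --> (0 : R).
Proof.
move=> cf fs sol osc dich; apply/cvgrPdist_le => e e0.
have [T1 h1] := eventually_le cf fs sol osc dich e0.
have cfN : continuous (fun y => - f (- y)).
  by move=> y; apply: continuousN; apply: continuous_comp; [exact: opp_continuous|exact: cf].
have fsN y : y != 0 -> 0 < y * - f (- y).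
  by move=> y0; rewrite mulrN -mulNr fs// oppr_eq0.
have [T2 h2] := eventually_le cfN fsN (solvesN cf sol) (small_oscillationN osc)
  (bounded_or_oscillatingN dich) e0.
exists (Num.max T1 T2); split; first exact: num_real.
move=> t; rewrite gt_max => /andP[/ltW/h1 ? /ltW/h2 ?].
by rewrite sub0r normrN ler_norml; apply/andP; split; lra.
Qed.

(** The increment of [i] is that of [x] plus the drift over a unit of time. Each end value of [x]
    takes a third of [e], and so does the drift, since [f] is small near 0. *)
Lemma cvg0_oscillation (f x i : R -> R) (xi : R) : continuous f -> f 0 = 0 ->
  solves f x i xi -> x t @[t --> +oo] --> (0 : R) ->
  forall e, 0 < e -> exists N : nat, forall n : nat, (N <= n)%N ->
    `|i n.+1%:R - i n%:R| <= e.
Proof.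
move=> cf f00 sol xc e e0.
have e3 : 0 < e / 3 by rewrite divr_gt0.
have /cvgrPdist_le/(_ _ e3)/nbhs_ballP[dl /= dl0 hdl] := cf 0.
pose c := Num.min (dl / 2) (e / 3).
have c0 : 0 < c by rewrite lt_min e3 divr_gt0.
have [cd ce] : c <= dl / 2 /\ c <= e / 3 by split; rewrite /c ge_min lexx ?orbT.
have /cvgrPdist_le/(_ _ c0)[T [Treal hT]] := xc.
have {}hT t : T < t -> `|x t| <= c by move=> /hT; rewrite sub0r normrN.
have hf t : T < t -> `|f (x t)| <= e / 3.
  move=> /hT xt; have := hdl (x t); rewrite f00 sub0r normrN; apply.
  by rewrite /ball/= sub0r normrN; lra.
exists (Num.bound `|T|) => n hn.
have Tn : T < n%:R.
  apply: le_lt_trans (ler_norm T) _; apply: lt_le_trans (archi_boundP (normr_ge0 _)) _.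
  by rewrite ler_nat.
have nn : n%:R <= n.+1%:R :> R by rewrite ler_nat.
have [h1 h2] := solves_increment (- (e / 3)) (e / 3) cf sol (ler0n _ n) nn.
have hfr r : n%:R < r -> - (e / 3) <= f (x r) <= e / 3.
  by move=> nr; rewrite -ler_norml; apply: hf; exact: lt_trans nr.
have {}h1 := h1 (fun r nr _ => proj1 (andP (hfr r nr))).
have {}h2 := h2 (fun r nr _ => proj2 (andP (hfr r nr))).
have x1 := hT _ Tn; have x2 := hT _ (lt_le_trans Tn nn).
have E : n.+1%:R - n%:R = 1 :> R by rewrite -natr1 addrAC subrr add0r.
move: h1 h2 x1 x2; rewrite E !mulr1 !ler_norml.
by move=> ? ? /andP[? ?] /andP[? ?]; apply/andP; split; lra.
Qed.

End pathwise.

(** * Necessity of (A) *)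

Section divergence.
Context (d : measure_display) (T : measurableType d)
    (R : realType) (P : probability T R) (F : R -> set (set T)) (B : R -> T -> R).
Hypotheses (hF : complete_filtration P F) (hB : brownian_motion P F B).
Variable sigma : R -> R.
Hypothesis hsigma : {within `[0, +oo[, continuous sigma}.
Variable I : R -> T -> R.
Hypothesis hI : ito_integral_process P F B sigma I.
Variable theta : nat -> R.
Hypotheses (htheta0 : forall n, 0 <= theta n)
  (htheta : forall n, theta n ^+ 2 = var sigma n%:R n.+1%:R).

(** The bound of [increment_lower_tail] for the conditional probability, given time [n], that the
    increment over the next unit of time exceeds [x]. *)
Definition tail_lower_bound (x : R) (n : nat) : R := if theta n == 0 then 0
  else 4^-1 * expR (- (256 * (x ^+ 2 / theta n ^+ 2 + 1))).

Let p := tail_lower_bound.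

Let p_ge0 x n : 0 <= p x n.
Proof.
rewrite /p /tail_lower_bound; case: ifP => _; first exact: lexx.
by apply: mulr_ge0; [rewrite invr_ge0 ler0n|exact: expR_ge0].
Qed.

Let D n w := I n.+1%:R w - I n%:R w.

Let mD n : measurable_wrt (F n.+1%:R) (D n).
Proof.
apply: measurable_wrtB; first exact: filtration_sigma hF _ _.
  exact: (ito_wrt hF hI).
by apply: (ito_wrt hF hI) => //; rewrite ler_nat.
Qed.

Let A x N k := [set w | forall j, (j < k)%N -> `|D (N + j) w| <= x].

Let AS x N k : A x N k.+1 = A x N k `&` ~` [set w | x < `|D (N + k) w|].
Proof.
apply/seteqP; split => w.
  move=> h; split; first by move=> j jk; apply: h; exact: ltnW.
  by apply/negP; rewrite /= -leNgt; exact: h.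
move=> [h /negP]; rewrite -leNgt => hk j; rewrite ltnS leq_eqVlt => /predU1P[->//|].
exact: h.
Qed.

Let FA x N k : F (N + k)%:R (A x N k).
Proof.
have sF n : sigma_algebra setT (F n%:R) by exact: filtration_sigma hF _ _.
elim: k => [|k ih].
  have -> : A x N 0 = setT by apply/seteqP; split.
  by rewrite -(sigma_algebra_id (sF _)); exact: (@measurableT _ (g_sigma_algebraType _)).
rewrite AS addnS -(sigma_algebra_id (sF _)).
apply: (@measurableI _ (g_sigma_algebraType (F (N + k).+1%:R))).
  rewrite /measurable/= sigma_algebra_id//.
  by apply: (filtration_le hF) ih => //; rewrite ler_nat.
apply: (@measurableC _ (g_sigma_algebraType (F (N + k).+1%:R))).
rewrite /measurable/= sigma_algebra_id//.
have -> : [set w | x < `|D (N + k) w|] = D (N + k) @^-1` [set y | x < `|y|] by [].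
have h : measurable_wrt (F (N + k).+1%:R) (D (N + k)) by exact: mD.
by apply: measurable_wrt_preimage h; apply: (@measurable_abs_gt _ _ _ id).
Qed.

Let mA x N k : measurable (A x N k).
Proof. by have := filtration_measurable hF (ler0n R (N + k)); apply. Qed.

(** Conditional form of the second Borel-Cantelli lemma: each step retains at most the fraction
    [1 - p] of an event of the past, and [1 - p <= expR (- p)]. *)
Lemma pr_small_increments x N k : 0 < x ->
  pr P (A x N k) <= expR (- \sum_(j < k) p x (N + j)).
Proof.
move=> x0; elim: k => [|k ih].
  by rewrite big_ord0 oppr0 expR0; exact: pr_le1.
have mE : measurable [set w | x < `|D (N + k) w|].
  apply: measurable_abs_gt; apply: (@measurable_wrt_measurable _ _ _ (F (N + k).+1%:R)).
    exact: filtration_measurable hF _ _.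
  exact: mD.
have step : p x (N + k) * pr P (A x N k) <=
    pr P (A x N k `&` [set w | x < `|D (N + k) w|]).
  rewrite /p /tail_lower_bound; have [th0|thn] := eqVneq (theta (N + k)%N) 0.
    by rewrite mul0r pr_ge0.
  have v0 : 0 < var sigma (N + k)%:R (N + k).+1%:R.
    by rewrite -htheta exprn_even_gt0.
  have lt1 : (N + k)%:R < (N + k).+1%:R :> R by rewrite ltr_nat.
  have [h _] := increment_lower_tail hF hB hsigma hI (ler0n _ _) lt1 v0 x0 (FA x N k).
  rewrite htheta mulrC; apply: le_trans h _; apply: le_pr.
  - apply: measurableI => //; apply: measurable_gt; apply: measurable_funB;
      exact: (ito_measurable hF hI).
  - exact: measurableI.
  - move=> w [Aw /= xw]; split=> //=; apply: lt_le_trans xw _; exact: ler_norm.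
rewrite AS; have := prID P (mA x N k) mE => h.
have : pr P (A x N k `&` ~` [set w | x < `|D (N + k) w|]) <=
    pr P (A x N k) * (1 - p x (N + k)) by lra.
move=> /le_trans; apply.
apply: (@le_trans _ _ (pr P (A x N k) * expR (- p x (N + k)))).
  by rewrite ler_wpM2l ?pr_ge0// (le_trans _ (expR_ge1Dx _)).
by rewrite big_ord_recr/= opprD expRD ler_wpM2r// expR_ge0.
Qed.

(** [Z] is an arbitrary set, hence negligibility in place of measure zero. It is covered by the
    events that all increments from [N] on stay within [x], and each of these would be negligible if
    the sums were unbounded. *)
Lemma bounded_tail_lower_bounds (Z : set T) x : 0 < x -> ~ P.-negligible Z ->
  (Z `<=` [set w | forall e, 0 < e -> exists N : nat, forall n : nat, (N <= n)%N ->
     `|I n.+1%:R w - I n%:R w| <= e]) ->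
  exists K, forall n, \sum_(k < n) p x k <= K.
Proof.
move=> x0 Zneg hZ; apply: contrapT => hK.
have {}hK K : exists n, K < \sum_(k < n) p x k.
  apply: contrapT => h; apply: hK; exists K => n.
  by rewrite leNgt; apply/negP => hn; apply: h; exists n.
apply: Zneg.
have neg N : P.-negligible (\bigcap_k A x N k).
  apply: pr0_negligible; first exact: bigcap_measurable.
  apply/ler_addgt0Pr => e e0; rewrite add0r; apply: pr_bigcap_le => //.
  (* The part [z] of the sum from index [N] on is then at least [e^-1], and [expR (- z) <= e]
     follows. *)
  have [n hn] := hK (e^-1 + \sum_(k < N) p x k).
  exists n; apply: le_trans (pr_small_increments N n x0) _.
  set z := \sum_(j < n) _.
  have hz : e^-1 <= z.
    have : \sum_(k < n) p x k <= \sum_(k < N + n) p x k.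
      by rewrite addnC big_split_ord/= lerDl sumr_ge0.
    by rewrite [X in _ <= X -> _]big_split_ord/= -/z; lra.
  have h := expR_ge1Dx z; have E0 := expR_gt0 z.
  rewrite expRN -[leRHS]invrK lef_pV2 ?posrE ?invr_gt0//.
  by lra.
apply: (negligibleS _ (negligible_bigcup neg)) => w /hZ /(_ x x0)[N hN].
by exists N => // k _ j _; apply: hN; exact: leq_addr.
Qed.

(** At [x = eps / 32] the product [256 * x ^+ 2] is [eps ^+ 2 / 4], less than the [eps ^+ 2 / 2] of
    the summand, whose exponential is thus at most [C * p x n]. The factor [theta n] is eventually
    at most 1. *)
Lemma summable_of_bounded :
  (forall x, 0 < x -> exists K, forall n, \sum_(k < n) p x k <= K) ->
  forall eps, 0 < eps -> (\sum_(1 <= n <oo) (summand theta eps n)%:E < +oo)%E.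
Proof.
move=> hp eps eps0.
pose x := eps / 32.
have x0 : 0 < x by rewrite divr_gt0.
have [K hK] := hp x x0.
have pcvg : p x n @[n --> \oo] --> (0 : R).
  apply: cvg_series_cvg_0; apply: nondecreasing_is_cvgn.
    by apply/nondecreasing_seqP => n; rewrite /series/= big_nat_recr//= lerDl.
  by exists K => _ [n _ <-]; rewrite /series/= big_mkord.
(* A lower bound for [p x n] whenever [theta n > 1]; as [p x n] tends to 0, this happens only
   finitely often. *)
pose c1 := 4^-1 * expR (- (256 * (x ^+ 2 + 1))).
have q0 : 0 < 4^-1 :> R by rewrite invr_gt0 ltr0n.
have h256 : 0 < 256 :> R by rewrite ltr0n.
have c10 : 0 < c1 by apply: mulr_gt0 q0 _; exact: expR_gt0.
have [N hN] : exists N, forall n, (N <= n)%N -> theta n <= 1.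
  have /cvgrPdist_lt/(_ _ c10)[N _ hN] := pcvg.
  exists N => n /hN /=; rewrite sub0r normrN ger0_norm// => hpn.
  rewrite leNgt; apply/negP => th1.
  have th0 : theta n != 0 by rewrite gt_eqF// (lt_trans ltr01).
  move: hpn; rewrite /p /tail_lower_bound (negbTE th0) ltNge => /negP; apply.
  rewrite (ler_pM2l q0) ler_expR lerN2 (ler_pM2l h256) lerD2r ler_pdivrMr; last first.
    by rewrite exprn_even_gt0.
  rewrite ler_peMr ?sqr_ge0// -[leLHS](expr1n _ 2) lerXn2r ?nnegrE// ltW//.
pose C : R := 4 * expR 256.
have C0 : 0 < C by apply: mulr_gt0; [rewrite ltr0n|exact: expR_gt0].
have s0 n : 0 <= summand theta eps n.
  by rewrite /summand; case: ifP => // _; rewrite mulr_ge0// expR_ge0.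
have hs n : (N <= n)%N -> summand theta eps n <= C * p x n.
  move=> /hN th1; rewrite /summand /p /tail_lower_bound.
  have [th0|thn] := eqVneq (theta n) 0; first by rewrite mulr0.
  have th0 : 0 < theta n ^+ 2 by rewrite exprn_even_gt0.
  apply: (@le_trans _ _ (expR (- (1 / 2) * (eps ^+ 2 / theta n ^+ 2)))).
    by rewrite ler_piMl// expR_ge0.
  have -> : C * (4^-1 * expR (- (256 * (x ^+ 2 / theta n ^+ 2 + 1)))) =
      expR (- (256 * (x ^+ 2 / theta n ^+ 2))).
    rewrite /C mulrACA divff// mul1r -expRD; congr expR; ring.
  rewrite ler_expR.
  have -> : 256 * (x ^+ 2 / theta n ^+ 2) = 4^-1 * (eps ^+ 2 / theta n ^+ 2).
    by rewrite /x; field; exact: thn.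
  by rewrite mulNr lerN2 ler_wpM2r ?divr_ge0 ?sqr_ge0//; lra.
have bnd n : \sum_(1 <= k < n) summand theta eps k <=
    \sum_(k < N) summand theta eps k + C * K.
  apply: (@le_trans _ _ (\sum_(k < N + n) summand theta eps k)).
    apply: (@le_trans _ _ (\sum_(k < n) summand theta eps k)); last first.
      by rewrite addnC big_split_ord/= lerDl sumr_ge0.
    case: n => [|n]; first by rewrite big_geq// sumr_ge0.
    by rewrite -(big_mkord xpredT (summand theta eps)) [leRHS]big_ltn// lerDr.
  rewrite big_split_ord/= lerD2l.
  apply: (@le_trans _ _ (C * \sum_(k < n) p x (N + k))).
    by rewrite mulr_sumr; apply: ler_sum => k _; apply: hs; exact: leq_addr.
  rewrite ler_pM2l//; apply: le_trans (hK (N + n)%N).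
  by rewrite [leRHS]big_split_ord/= lerDr sumr_ge0.
apply: (@le_lt_trans _ _ (\sum_(k < N) summand theta eps k + C * K)%:E); last exact: ltry.
apply: lime_le; first by apply: is_cvg_nneseries => n _ _; rewrite lee_fin.
by apply: nearW => n; rewrite sumEFin lee_fin.
Qed.

End divergence.

(** * Equivalence of (A), (B) and (C) *)

Theorem theorem9 (R : realType) (d : measure_display) (T : measurableType d)
    (P : probability T R) (F : R -> set (set T)) (B : R -> T -> R)
    (hF : complete_filtration P F) (hB : brownian_motion P F B)
    (f : R -> R) (hf : continuous f) (hf_sign : forall x : R, x != 0 -> 0 < x * f x)
    (hf0 : f 0 = 0)
    (sigma : R -> R) (hsigma : {within `[0, +oo[, continuous sigma})
    (X : R -> R -> T -> R)
    (hX : forall xi, is_solution P F B f sigma xi (X xi))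
    (theta : nat -> R) (htheta0 : forall n, 0 <= theta n)
    (htheta : forall n, theta n ^+ 2 =
       (\int[lebesgue_measure]_(s in `[n%:R, n.+1%:R]) (sigma s ^+ 2))%R) :
  let condA := forall eps : R, 0 < eps ->
    (\sum_(1 <= n <oo)
       (if theta n == 0 then 0
        else theta n * expR (- (1 / 2) * (eps ^+ 2 / theta n ^+ 2)))%R%:E
     < +oo)%E in
  let to_zero (xi : R) : set T :=
    [set w | X xi t w @[t --> +oo] --> (0 : R)] in
  let condB := exists xi : R,
    (0 < P (to_zero xi))%E in
  let condC := forall xi : R,
    {ae P, forall w, to_zero xi w} in
  (condA <-> condB) /\ (condB <-> condC).
Proof.
move=> condA to_zero condB condC.
have Cmpl : P.-negligible `<=` measurable by case: hF.
have AC : condA -> condC.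
  move=> hA xi; have [cX aX [I [hI hX']]] := hX xi.
  have osc := ae_oscillation hF hB hsigma hI htheta0 htheta hA.
  have cI : continuous_process P I by case: hI.
  have dich : {ae P, forall w, bounded_or_oscillating (fun t => I t w)}.
    have [[V hV]|hV] := pselect (exists V, forall n, \sum_(k < n) theta k ^+ 2 <= V).
      apply: filterS (ae_bounded hF hB hsigma hI htheta hV) => w [K hK].
      left; exists (K + `|I 0 w|) => n.
      have -> : I n%:R w = (I n%:R w - I 0 w) + I 0 w by ring.
      by apply: le_trans (ler_normD _ _) _; rewrite lerD2r.
    have {}hV V : exists n, V < \sum_(k < n) theta k ^+ 2.
      apply: contrapT => h; apply: hV; exists V => n.
      by rewrite leNgt; apply/negP => hn; apply: h; exists n.
    apply: filterS (ae_ito_unbounded hF hB hsigma hI htheta hV) => w h.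
    by right.
  apply: filterS2 (filterI cX hX') (filterI osc dich) => w [cw Xw] [ow dw].
  exact: (solves_cvg0 hf hf_sign (conj cw Xw) ow dw).
have BA : condB -> condA.
  move=> [xi hxi]; have [cX aX [I [hI hX']]] := hX xi.
  apply: (summable_of_bounded htheta0) => x x0.
  (* The deterministic analysis applies only where the path is continuous and solves the equation;
     discarding the negligible rest preserves non-negligibility. *)
  pose good := [set w | {within `[0, +oo[, continuous (fun t => X xi t w)} /\
    forall t : R, 0 <= t -> X xi t w =
      xi - (\int[lebesgue_measure]_(s in `[0, t]) f (X xi s w))%R + I t w].
  have badneg : P.-negligible (~` good).
    exact: (filterI cX hX').
  apply: (bounded_tail_lower_bounds hF hB hsigma hI htheta (Z := to_zero xi `&` good)) => //.
    move=> neg; have : P.-negligible (to_zero xi).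
      apply: (@negligibleS _ _ _ _ (to_zero xi `&` good `|` ~` good)); last exact: negligibleU.
      by move=> w zw; have [gw|gw] := pselect (good w); [left|right].
    move=> n; move: hxi; have mz := Cmpl _ n.
    by rewrite (measure_negligible mz n) ltxx.
  by move=> w [zw gw]; apply: (cvg0_oscillation hf hf0 gw zw).
have CB : condC -> condB.
  move=> hC; exists 0.
  have n0 : P.-negligible (~` to_zero 0) := hC 0.
  have m0 := Cmpl _ n0.
  have mz : measurable (to_zero 0) by rewrite -(setCK (to_zero 0)); exact: measurableC.
  have : P (~` to_zero 0) = 0%E by exact: measure_negligible.
  rewrite probability_setC// => h.
  rewrite lt_neqAle measure_ge0 andbT; apply/negP => /eqP h0.
  by move: h; rewrite -h0 sube0 => /eqP; rewrite onee_eq0.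
by split; split; auto.
Qed.
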